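(* Assume that $\mathrm{ZF}$ is consistent. Then $\mathrm{IZF}_{Ref}$ does not prove the statement ''every Cauchy sequence of rationals has a modulus of convergence''. It follows that $\mathrm{IZF}_{Ref}$ does not prove the statement ''every Cauchy sequence of sequence-modulus pairs converges to a Cauchy sequence (of rationals) with a modulus of convergence''.
   Context: $\mathrm{IZF}_{Ref}$ is the theory in first-order intuitionistic logic with equality, in the language $\{\in\}$, with axioms: Extensionality, Empty Set, Pairing, Union, Infinity, Power Set, the Set Induction schema $(\forall x\,((\forall y\in x\;\phi(y))\to\phi(x)))\to\forall x\,\phi(x)$, the full Separation schema, and the Reflection schema: for every formula $\phi(x)$ (possibly with parameters) and every set $z$ there is a transitive set $Z$ containing $z$ and the parameters such that for all $x\in Z$, $\phi(x)$ holds iff $\phi(x)$ holds relativized to $Z$. (It is IZF with Collection replaced by Reflection.) The following notions are formalized in the language of set theory. A Cauchy sequence (of rationals) is a function $X:\mathbb N\to\mathbb Q$ such that for every positive rational $\epsilon$ there is $N\in\mathbb N$ with $|X(n)-X(m)|<\epsilon$ for all $m,n>N$. A modulus of convergence for $X$ is a function $f$ from the positive rationals to $\mathbb N$ such that for every positive rational $\epsilon$, $|X(n)-X(m)|<\epsilon$ for all $m,n>f(\epsilon)$. A sequence-modulus pair is a pair $\langle X,f\rangle$ with $X$ a Cauchy sequence of rationals and $f$ a modulus of convergence for $X$. For Cauchy sequences $x,y$, the distance $d(x,y)$ is the sequence $n\mapsto|x(n)-y(n)|$; $x<y$ means that there are $m,N\in\mathbb N$, $m\ge 1$, with $x(k)+1/m<y(k)$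 for all $k>N$; a rational is identified with the corresponding constant sequence. A sequence $\langle X_j\mid j\in\mathbb N\rangle$ of Cauchy sequences is Cauchy if for every positive rational $\epsilon$ there is $N$ with $d(X_j,X_k)<\epsilon$ for all $j,k>N$; it converges to a Cauchy sequence $Y$ (its limit) if for every positive rational $\epsilon$ there is $N$ with $d(X_j,Y)<\epsilon$ for all $j>N$. A sequence $\langle \langle X_j,f_j\rangle\mid j\in\mathbb N\rangle$ of sequence-modulus pairs is Cauchy (resp. converges to $Y$) if $\langle X_j\mid j\in\mathbb N\rangle$ is Cauchy (resp. converges to $Y$). *)

(* Defs.v *)
From Stdlib Require Import List.
Import ListNotations.

(** * First-order logic over the language {∈}

    The only terms are variables, written as de Bruijn indices. *)

Inductive form : Type :=
| Fal : form
| Eq  : nat -> nat -> form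
| Mem : nat -> nat -> form
| And : form -> form -> form
| Or  : form -> form -> form
| Imp : form -> form -> form
| All : form -> form
| Ex  : form -> form.

Definition up (s : nat -> nat) (i : nat) : nat :=
  match i with 0 => 0 | S j => S (s j) end.

Fixpoint ren (s : nat -> nat) (A : form) : form :=
  match A with
  | Fal => Fal
  | Eq i j => Eq (s i) (s j)
  | Mem i j => Mem (s i) (s j)
  | And B C => And (ren s B) (ren s C)
  | Or B C => Or (ren s B) (ren s C)
  | Imp B C => Imp (ren s B) (ren s C)
  | All B => All (ren (up s) B)
  | Ex B => Ex (ren (up s) B)
  end.

Definition shift : form -> form := ren S.

(** [subst0 y A] puts the variable [y] for index 0 and lowers the others. *)
Definition subst0 (y : nat) : form -> form :=
  ren (fun i => match i with 0 => y | S j => j end).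

Definition lower (l : list nat) : list nat :=
  flat_map (fun i => match i with 0 => [] | S j => [j] end) l.

Fixpoint fv (A : form) : list nat :=
  match A with
  | Fal => []
  | Eq i j | Mem i j => [i; j]
  | And B C | Or B C | Imp B C => fv B ++ fv C
  | All B | Ex B => lower (fv B)
  end.

(** Relativization of all quantifiers to the set denoted by the variable [z]. *)
Fixpoint relativize (z : nat) (A : form) : form :=
  match A with
  | Fal => Fal
  | Eq i j => Eq i j
  | Mem i j => Mem i j
  | And B C => And (relativize z B) (relativize z C)
  | Or B C => Or (relativize z B) (relativize z C)
  | Imp B C => Imp (relativize z B) (relativize z C)
  | All B => All (Imp (Mem 0 (S z)) (relativize (S z) B))
  | Ex B => Ex (And (Mem 0 (S z)) (relativize (S z) B))
  end.

Inductive logic : Type := intuitionistic | classical.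

(** Natural deduction.  Members of [T] may have free variables (the parameters
    of a schema); as [T_ax] is available in every context, such an axiom acts
    as its universal closure. *)
Inductive prv (L : logic) (T : form -> Prop) : list form -> form -> Prop :=
| T_ax G A : T A -> prv L T G A
| Hyp G A : In A G -> prv L T G A
| FalE G A : prv L T G Fal -> prv L T G A
| AndI G A B : prv L T G A -> prv L T G B -> prv L T G (And A B)
| AndE1 G A B : prv L T G (And A B) -> prv L T G A
| AndE2 G A B : prv L T G (And A B) -> prv L T G B
| OrI1 G A B : prv L T G A -> prv L T G (Or A B)
| OrI2 G A B : prv L T G B -> prv L T G (Or A B)
| OrE G A B C : prv L T G (Or A B) ->
    prv L T (A :: G) C -> prv L T (B :: G) C -> prv L T G C
| ImpI G A B : prv L T (A :: G) B -> prv L T G (Imp A B)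
| ImpE G A B : prv L T G (Imp A B) -> prv L T G A -> prv L T G B
| AllI G A : prv L T (map shift G) A -> prv L T G (All A)
| AllE G A y : prv L T G (All A) -> prv L T G (subst0 y A)
| ExI G A y : prv L T G (subst0 y A) -> prv L T G (Ex A)
| ExE G A C : prv L T G (Ex A) ->
    prv L T (A :: map shift G) (shift C) -> prv L T G C
| EqRefl G x : prv L T G (Eq x x)
| EqSubst G A x y : prv L T G (Eq x y) ->
    prv L T G (subst0 x A) -> prv L T G (subst0 y A)
| DNE G A : L = classical ->
    prv L T G (Imp (Imp A Fal) Fal) -> prv L T G A.

Definition proves (L : logic) (T : form -> Prop) (A : form) : Prop :=
  prv L T [] A.

Definition consistent (L : logic) (T : form -> Prop) : Prop :=
  ~ proves L T Fal.

(** * Writing formulas with named binders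

    An [fm] is a formula that still awaits the number [d] of binders above it.
    A bound variable is known by its level, i.e. the number of binders above
    its own, so that inside [d] binders level [x] is the index [d - S x].
    [closed F] is the resulting formula at depth 0. *)

Definition fm : Type := nat -> form.
Definition lvl : Type := nat.

Definition index (d : nat) (x : lvl) : nat := d - S x.

Definition ffal : fm := fun _ => Fal.
Definition feq (x y : lvl) : fm := fun d => Eq (index d x) (index d y).
Definition fmem (x y : lvl) : fm := fun d => Mem (index d x) (index d y).
Definition fand (F G : fm) : fm := fun d => And (F d) (G d).
Definition for_ (F G : fm) : fm := fun d => Or (F d) (G d).
Definition fimp (F G : fm) : fm := fun d => Imp (F d) (G d).
Definition fiff (F G : fm) : fm := fand (fimp F G) (fimp G F).
Definition fall (F : lvl -> fm) : fm := fun d => All (F d (S d)).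
Definition fex (F : lvl -> fm) : fm := fun d => Ex (F d (S d)).

Definition closed (F : fm) : form := F 0.

Declare Scope fm_scope.
Delimit Scope fm_scope with fm.
Bind Scope fm_scope with fm.

Notation "x ≐ y" := (feq x y) (at level 70, no associativity) : fm_scope.
Notation "x ∈ y" := (fmem x y) (at level 70, no associativity) : fm_scope.
Notation "¬ F" := (fimp F ffal) (at level 75, right associativity) : fm_scope.
Notation "F ∧ G" := (fand F G) (at level 80, right associativity) : fm_scope.
Notation "F ∨ G" := (for_ F G) (at level 85, right associativity) : fm_scope.
Notation "F ⇒ G" := (fimp F G) (at level 99, right associativity, G at level 200)
  : fm_scope.
Notation "F ⇔ G" := (fiff F G) (at level 95, no associativity) : fm_scope.
Notation "∀ x .. y , F" := (fall (fun x => .. (fall (fun y => F)) ..))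
  (at level 200, x binder, y binder, right associativity) : fm_scope.
Notation "∃ x .. y , F" := (fex (fun x => .. (fex (fun y => F)) ..))
  (at level 200, x binder, y binder, right associativity) : fm_scope.

Local Open Scope fm_scope.

(** A schematic formula [A] as an [fm]: its indices 0, 1, ... are replaced by
    the levels in [l], and the remaining ones are parameters, which lie outside
    all binders. *)
Definition inst (A : form) (l : list lvl) : fm := fun d =>
  ren (fun i => match nth_error l i with
                | Some x => index d x
                | None => d + (i - length l)
                end) A.

(** A definable term, given by its graph: [t z] says that [z] is the value of
    [t]. *)
Definition tm : Type := lvl -> fm.

Definition var (x : lvl) : tm := fun z => z ≐ x.
Coercion var : lvl >-> tm.

Definition bind (t : tm) (F : lvl -> fm) : fm := ∃ x, t x ∧ F x.
Notation "x ← t ;; F" := (bind t (fun x => F))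
  (at level 199, t at level 100, F at level 200, right associativity) : fm_scope.

Definition teq (s t : tm) : fm := x ← s ;; y ← t ;; x ≐ y.
Definition tmem (s t : tm) : fm := x ← s ;; y ← t ;; x ∈ y.

(** * Basic set-theoretic notions *)

Definition subset (x y : lvl) : fm := ∀ z, z ∈ x ⇒ z ∈ y.
Definition transitive (x : lvl) : fm := ∀ y, y ∈ x ⇒ subset y x.

Definition empty : tm := fun z => ∀ w, ¬ w ∈ z.
Definition succ (t : tm) : tm := fun z =>
  x ← t ;; ∀ w, w ∈ z ⇔ w ∈ x ∨ w ≐ x.
Definition upair (s t : tm) : tm := fun z =>
  x ← s ;; y ← t ;; ∀ w, w ∈ z ⇔ w ≐ x ∨ w ≐ y.
Definition opair (s t : tm) : tm := fun z =>
  x ← s ;; y ← t ;; upair (upair x x) (upair x y) z.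

Definition inductive (I : lvl) : fm :=
  tmem empty I ∧ ∀ x, x ∈ I ⇒ tmem (succ x) I.

Definition Nat (n : lvl) : fm := ∀ I, inductive I ⇒ n ∈ I.

(** [Fun A B f]: the set [f] is a function from the class [A] to the class
    [B]. *)
Definition Fun (A B : lvl -> fm) (f : lvl) : fm :=
  (∀ p, p ∈ f ⇒ ∃ x y, A x ∧ B y ∧ opair x y p) ∧
  (∀ x, A x ⇒ ∃ y, tmem (opair x y) f ∧ ∀ y', tmem (opair x y') f ⇒ y' ≐ y).

Definition ap (f t : tm) : tm := fun z =>
  g ← f ;; x ← t ;; tmem (opair x z) g.

(** * Natural and rational numbers *)

Definition one : tm := succ empty.

Definition nadd (s t : tm) : tm := fun z =>
  x ← s ;; y ← t ;; ∃ f, Fun Nat Nat f ∧ teq (ap f empty) x ∧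
  (∀ n, Nat n ⇒ teq (ap f (succ n)) (succ (ap f n))) ∧ ap f y z.

Definition nmul (s t : tm) : tm := fun z =>
  x ← s ;; y ← t ;; ∃ f, Fun Nat Nat f ∧ teq (ap f empty) empty ∧
  (∀ n, Nat n ⇒ teq (ap f (succ n)) (nadd (ap f n) x)) ∧ ap f y z.

Definition Natpos (n : lvl) : fm := Nat n ∧ tmem empty n.

(** A rational number is an equivalence class of triples [((i, j), k)] of
    natural numbers with [k] positive, where [((i, j), k)] stands for the
    fraction (i - j) / k.  [frac a b d] is the class of [((a, b), d)]. *)
Definition frac (a b d : tm) : tm := fun q =>
  a ← a ;; b ← b ;; d ← d ;; Nat a ∧ Nat b ∧ Natpos d ∧
  ∀ t, t ∈ q ⇔ ∃ i j k, Nat i ∧ Nat j ∧ Natpos k ∧ opair (opair i j) k t ∧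
    teq (nadd (nmul i d) (nmul b k)) (nadd (nmul a k) (nmul j d)).

Definition Rat (q : lvl) : fm := ∃ a b d, frac a b d q.

Definition qlt (s t : tm) : fm :=
  p ← s ;; q ← t ;; ∃ a b d a' b' d', frac a b d p ∧ frac a' b' d' q ∧
  tmem (nadd (nmul a d') (nmul b' d)) (nadd (nmul a' d) (nmul b d')).

Definition qadd (s t : tm) : tm := fun r =>
  p ← s ;; q ← t ;; ∃ a b d a' b' d', frac a b d p ∧ frac a' b' d' q ∧
  frac (nadd (nmul a d') (nmul a' d)) (nadd (nmul b d') (nmul b' d))
       (nmul d d') r.

Definition qopp (t : tm) : tm := fun r =>
  q ← t ;; ∃ a b d, frac a b d q ∧ frac b a d r.

Definition qsub (s t : tm) : tm := qadd s (qopp t).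

Definition qzero : tm := frac empty empty one.

Definition qabs (t : tm) : tm := fun r =>
  q ← t ;; (¬ qlt q qzero ∧ r ≐ q) ∨ (qlt q qzero ∧ qopp q r).

Definition qinv_nat (m : tm) : tm := frac one empty m.

Definition Ratpos (q : lvl) : fm := Rat q ∧ qlt qzero q.

(** * Cauchy sequences and moduli of convergence *)

Definition CauchySeq (X : lvl) : fm :=
  Fun Nat Rat X ∧
  ∀ ε, Ratpos ε ⇒ ∃ N, Nat N ∧
    ∀ m n, Nat m ∧ Nat n ∧ N ∈ m ∧ N ∈ n ⇒
      qlt (qabs (qsub (ap X n) (ap X m))) ε.

Definition Modulus (f X : lvl) : fm :=
  Fun Ratpos Nat f ∧
  ∀ ε, Ratpos ε ⇒
    ∀ m n, Nat m ∧ Nat n ∧ tmem (ap f ε) m ∧ tmem (ap f ε) n ⇒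
      qlt (qabs (qsub (ap X n) (ap X m))) ε.

Definition SeqModPair (p : lvl) : fm :=
  ∃ X f, CauchySeq X ∧ Modulus f X ∧ opair X f p.

Definition dist (s t : tm) : tm := fun z =>
  x ← s ;; y ← t ;; Fun Nat Rat z ∧
  ∀ n, Nat n ⇒ teq (ap z n) (qabs (qsub (ap x n) (ap y n))).

Definition const (q : tm) : tm := fun z =>
  c ← q ;; Fun Nat Rat z ∧ ∀ n, Nat n ⇒ teq (ap z n) c.

Definition slt (s t : tm) : fm :=
  x ← s ;; y ← t ;; ∃ m N, Natpos m ∧ Nat N ∧
  ∀ k, Nat k ∧ N ∈ k ⇒ qlt (qadd (ap x k) (qinv_nat m)) (ap y k).

Definition CauchyOfSeqs (W : lvl) : fm :=
  ∀ ε, Ratpos ε ⇒ ∃ N, Nat N ∧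
    ∀ j k, Nat j ∧ Nat k ∧ N ∈ j ∧ N ∈ k ⇒
      slt (dist (ap W j) (ap W k)) (const ε).

Definition ConvergesSeqs (W Y : lvl) : fm :=
  ∀ ε, Ratpos ε ⇒ ∃ N, Nat N ∧
    ∀ j, Nat j ∧ N ∈ j ⇒ slt (dist (ap W j) Y) (const ε).

(** From a sequence [P] of pairs [(X_j, f_j)], the sequence of the [X_j]. *)
Definition firsts (P : lvl) : tm := fun W =>
  Fun Nat CauchySeq W ∧
  ∀ j, Nat j ⇒ ∃ f, teq (ap P j) (opair (ap W j) f).

Definition CauchyOfPairs (P : lvl) : fm := W ← firsts P ;; CauchyOfSeqs W.
Definition ConvergesPairs (P Y : lvl) : fm := W ← firsts P ;; ConvergesSeqs W Y.

Definition every_Cauchy_has_modulus : form := closed (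
  ∀ X, CauchySeq X ⇒ ∃ f, Modulus f X).

Definition every_Cauchy_of_pairs_converges : form := closed (
  ∀ P, Fun Nat SeqModPair P ∧ CauchyOfPairs P ⇒
    ∃ Y, CauchySeq Y ∧ (∃ f, Modulus f Y) ∧ ConvergesPairs P Y).

(** * Axioms of set theory *)

Definition ax_extensionality : form := closed (
  ∀ x y, (∀ z, z ∈ x ⇔ z ∈ y) ⇒ x ≐ y).
Definition ax_empty : form := closed (∃ x, empty x).
Definition ax_pairing : form := closed (∀ x y, ∃ z, upair x y z).
Definition ax_union : form := closed (
  ∀ x, ∃ y, ∀ z, z ∈ y ⇔ ∃ w, w ∈ x ∧ z ∈ w).
Definition ax_infinity : form := closed (∃ I, inductive I).
Definition ax_power : form := closed (∀ x, ∃ y, ∀ z, z ∈ y ⇔ subset z x).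
Definition ax_foundation : form := closed (
  ∀ x, (∃ y, y ∈ x) ⇒ ∃ y, y ∈ x ∧ ∀ z, z ∈ y ⇒ ¬ z ∈ x).

Definition ax_induction (A : form) : form := closed (
  (∀ x, (∀ y, y ∈ x ⇒ inst A [y]) ⇒ inst A [x]) ⇒ ∀ x, inst A [x]).

Definition ax_separation (A : form) : form := closed (
  ∀ z, ∃ y, ∀ x, x ∈ y ⇔ x ∈ z ∧ inst A [x]).

Definition ax_replacement (A : form) : form := closed (
  ∀ z, (∀ x, x ∈ z ⇒ ∀ y y', inst A [x; y] ∧ inst A [x; y'] ⇒ y ≐ y') ⇒
    ∃ w, ∀ y, y ∈ w ⇔ ∃ x, x ∈ z ∧ inst A [x; y]).

(** All parameters of [A], i.e. its free variables other than index 0, are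
    elements of [Z].  By the convention of [inst], index [S i] of [A] becomes
    index [d + i] inside [d] binders. *)
Definition params_in (A : form) (Z : lvl) : fm := fun d =>
  fold_right (fun i B => And (Mem (d + i) (index d Z)) B) (Imp Fal Fal)
    (lower (fv A)).

Definition frelativize (Z : lvl) (F : fm) : fm := fun d =>
  relativize (index d Z) (F d).

Definition ax_reflection (A : form) : form := closed (
  ∀ z, ∃ Z, transitive Z ∧ z ∈ Z ∧ params_in A Z ∧
    ∀ x, x ∈ Z ⇒ (inst A [x] ⇔ frelativize Z (inst A [x]))).

Inductive IZF_Ref : form -> Prop :=
| IZF_extensionality : IZF_Ref ax_extensionality
| IZF_empty : IZF_Ref ax_empty
| IZF_pairing : IZF_Ref ax_pairing
| IZF_union : IZF_Ref ax_union
| IZF_infinity : IZF_Ref ax_infinity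
| IZF_power : IZF_Ref ax_power
| IZF_induction A : IZF_Ref (ax_induction A)
| IZF_separation A : IZF_Ref (ax_separation A)
| IZF_reflection A : IZF_Ref (ax_reflection A).

Inductive ZF : form -> Prop :=
| ZF_extensionality : ZF ax_extensionality
| ZF_empty : ZF ax_empty
| ZF_pairing : ZF ax_pairing
| ZF_union : ZF ax_union
| ZF_infinity : ZF ax_infinity
| ZF_power : ZF ax_power
| ZF_foundation : ZF ax_foundation
| ZF_separation A : ZF (ax_separation A)
| ZF_replacement A : ZF (ax_replacement A).

(* Main.v *)
From Stdlib Require Import List Arith ZArith Lia QArith Qabs Qround Lqa.
From Stdlib Require Import Classical ClassicalEpsilon FunctionalExtensionality.
Require Import Defs.
Import ListNotations.
Local Open Scope nat_scope.

(** The proof interprets set theory in the sheaves over a topological space.  A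
    set is a name, a well-founded tree whose edges carry subsets of the space,
    and a formula about names is forced at a point, where implication and
    universal quantification speak about a whole neighbourhood of the point.
    Intuitionistic deduction is sound for forcing ([soundness]), and over every
    space all axioms of IZF with Reflection are forced ([IZF_Ref_valid]).  The
    names are indexed by arbitrary types, so that together with classical logic
    and choice they behave like the class of names over a model of ZF: the
    reflecting set of the Reflection schema is a Skolem hull, made transitive,
    taken with all its members present everywhere.

    It remains to choose the space.  A sequence of locally constant rational
    functions on the space is, in the model, a sequence of rationals; it is a
    Cauchy sequence there as soon as it converges locally uniformly, and its
    limit is then a continuous real function on the space.  If some sequence [Y]
    of the model with a modulus [f] has the same limit, then for each positive
    [eps] the pair of natural number [f eps] and rational [Y (f eps + 1)] is
    locally constant, hence partitions the space into open sets on each of which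
    the limit varies by at most [2 eps].  On a connected space only constant
    functions admit such partitions, but there the locally constant sequences
    are constant too; on the Cantor space there are many sequences, but all
    partitions exist.  What is needed is a space that has many clopen sets, but
    none that are small for the limit function.

    The summable ideal is such a space: its points are the sets [s] of natural
    numbers for which the sum of [1 / (i + 1)] over [i] in [s] is finite, the
    topology is that of the distance in sum, and the sequence consists of the
    partial sums.  Let [F] be a relatively clopen neighbourhood of the empty
    set on which the sum is bounded by a small [b].  Go through the natural
    numbers in order and put each into a set [t] whenever the finite set built
    so far remains in [F] afterwards.  The sum of [t] is at most [b], so [t] is a
    point, and it belongs to [F], because it is a limit of finite sets in [F].
    But then a neighbourhood of [t] is contained in [F], so that all large
    numbers could be added and were added; and the harmonic series diverges
    ([not_approximable]).

    This refutes moduli for the sequence of partial sums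
    ([modulus_approximates]).  The partial sums, each regarded as a constant
    sequence with a trivial modulus, also form a Cauchy sequence of
    sequence-modulus pairs, and a limit of it with a modulus is excluded by the
    same argument ([pairs_approximate]). *)

(** * Topological spaces and names *)

(** A topology is given by its interior operator, as forcing uses nothing else:
    [near t P] says that [t] is an interior point of [P]. *)
Record space : Type := Space {
  pt : Type;
  near : pt -> (pt -> Prop) -> Prop;
  near_mono : forall t (P Q : pt -> Prop),
    (forall s, P s -> Q s) -> near t P -> near t Q;
  near_top : forall t (P : pt -> Prop), (forall s, P s) -> near t P;
  near_and : forall t (P Q : pt -> Prop),
    near t P -> near t Q -> near t (fun s => P s /\ Q s);
  near_here : forall t (P : pt -> Prop), near t P -> P t;
  near_near : forall t (P : pt -> Prop),
    near t P -> near t (fun s => near s P) }.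

Arguments near {s} _ _.
Arguments near_mono {s} t P Q.
Arguments near_top {s} t P.
Arguments near_and {s} t P Q.
Arguments near_here {s} t P.
Arguments near_near {s} t P.

(** The set [w i] is where the member [f i] is present.  It need not be open,
    since it is only used through its interior. *)
Inductive name (X : space) : Type :=
| Name (I : Type) (f : I -> name X) (w : I -> pt X -> Prop) : name X.
Arguments Name {X} I f w.

Section Forcing.
Variable X : space.
Implicit Types (t s r : pt X) (x y z v : name X).

Lemma near_iff t (P Q : pt X -> Prop) :
  (forall s, P s <-> Q s) -> (near t P <-> near t Q).
Proof. intros H; split; apply near_mono; intros s; apply H. Qed.

Lemma near_imp t (P Q : pt X -> Prop) :
  near t P -> (forall s, P s -> Q s) -> near t Q.
Proof. intros H K; revert H; apply near_mono, K. Qed.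

(** Interiors are open, so the hypothesis remains available on a whole
    neighbourhood of the points under consideration. *)
Lemma near_open t (P Q : pt X -> Prop) :
  (forall s, near s P -> Q s) -> near t P -> near t Q.
Proof. intros K H; apply near_near in H; revert H; apply near_mono, K. Qed.

Definition elt y t (c : name X) : Prop :=
  match y with Name J g v => exists j, near t (v j) /\ c = g j end.

Fixpoint eqn x y {struct x} : pt X -> Prop :=
  match x, y with Name K f w, Name J g v => fun t => near t (fun s =>
    (forall i, near s (w i) -> exists j, near s (v j) /\ eqn (f i) (g j) s) /\
    (forall j, near s (v j) -> exists i, near s (w i) /\ eqn (f i) (g j) s))
  end.

Definition mem x y t : Prop := exists c, elt y t c /\ eqn x c t.

Lemma elt_near y t c : elt y t c -> near t (fun s => elt y s c).
Proof.
  destruct y as [J g v]; intros (j & Hj & ->).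
  revert Hj; apply near_open; intros s Hs; exists j; auto.
Qed.

Lemma eqn_near x y t : eqn x y t -> near t (eqn x y).
Proof. destruct x, y; apply near_near. Qed.

Lemma mem_near x y t : mem x y t -> near t (mem x y).
Proof.
  intros (c & Hc & E).
  apply (near_imp _ _ _ (near_and _ _ _ (elt_near _ _ _ Hc) (eqn_near _ _ _ E))).
  intros s [H1 H2]; exists c; auto.
Qed.

Lemma eqn_refl x t : eqn x x t.
Proof.
  revert t; induction x as [I f IH w]; intros t; simpl.
  apply near_top; intros s; split; intros i Hi; exists i; auto.
Qed.

Lemma eqn_sym x y t : eqn x y t -> eqn y x t.
Proof.
  revert y t; induction x as [I f IH w]; intros [J g v] t; simpl.
  apply near_mono; intros s [H1 H2]; split.
  - intros j Hj; destruct (H2 j Hj) as (i & Hi & E); exists i; auto.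
  - intros i Hi; destruct (H1 i Hi) as (j & Hj & E); exists j; auto.
Qed.

Lemma eqn_trans x y z t : eqn x y t -> eqn y z t -> eqn x z t.
Proof.
  revert y z t; induction x as [I f IH w]; intros [J g v] [K h u] t H1 H2.
  simpl in *; apply (near_imp _ _ _ (near_and _ _ _ H1 H2)).
  clear H1 H2 t; intros s [[A1 A2] [B1 B2]]; split.
  - intros i Hi; destruct (A1 i Hi) as (j & Hj & E).
    destruct (B1 j Hj) as (k & Hk & E'); exists k; eauto.
  - intros k Hk; destruct (B2 k Hk) as (j & Hj & E).
    destruct (A2 j Hj) as (i & Hi & E'); exists i; eauto.
Qed.

Lemma eqn_char x y t : eqn x y t <->
  near t (fun s => (forall c, elt x s c -> mem c y s) /\
                   (forall c, elt y s c -> mem c x s)).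
Proof.
  destruct x as [I f w], y as [J g v]; simpl; split; apply near_mono;
    intros s [H1 H2]; split.
  - intros c (i & Hi & ->); destruct (H1 i Hi) as (j & Hj & E).
    exists (g j); split; [exists j|]; auto.
  - intros c (j & Hj & ->); destruct (H2 j Hj) as (i & Hi & E).
    exists (f i); split; [exists i|apply eqn_sym]; auto.
  - intros i Hi; destruct (H1 (f i)) as (c & (j & Hj & ->) & E); [exists i; auto|].
    exists j; auto.
  - intros j Hj; destruct (H2 (g j)) as (c & (i & Hi & ->) & E); [exists j; auto|].
    exists i; split; [|apply eqn_sym]; auto.
Qed.

Lemma elt_mem y t c : elt y t c -> mem c y t.
Proof. intros H; exists c; split; [exact H|apply eqn_refl]. Qed.

Lemma mem_eqn_l x x' y t : eqn x x' t -> mem x y t -> mem x' y t.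
Proof.
  intros E (c & Hc & E'); exists c; split; auto.
  apply eqn_trans with x; auto; apply eqn_sym; auto.
Qed.

Lemma mem_eqn_r x y y' t : eqn y y' t -> mem x y t -> mem x y' t.
Proof.
  intros E (c & Hc & E'); apply eqn_char in E; apply near_here in E.
  destruct E as [E _]; apply mem_eqn_l with c; [apply eqn_sym|]; auto.
Qed.

Lemma eqn_ext x y t :
  eqn x y t <-> near t (fun s => forall z, mem z x s <-> mem z y s).
Proof.
  split; intros H.
  - apply eqn_near in H; revert H; apply near_mono; intros s E z; split;
      apply mem_eqn_r; auto; apply eqn_sym; auto.
  - apply eqn_char; revert H; apply near_mono; intros s E; split; intros c Hc;
      apply E, elt_mem, Hc.
Qed.

Lemma mem_irrefl x t : ~ mem x x t.
Proof.
  revert t; induction x as [I f IH w]; intros t (c & (i & Hi & ->) & E).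
  apply (IH i t).
  apply mem_eqn_r with (Name I f w); auto.
  apply elt_mem; exists i; auto.
Qed.

(** * Forcing of formulas *)

Definition scons {A : Type} (a : A) (e : nat -> A) (i : nat) : A :=
  match i with 0 => a | S j => e j end.

(** Forcing with the quantifiers restricted to the class [D]; the
    unrestricted case is [sat] below, while the restricted one computes
    relativized formulas. *)
Fixpoint satD (D : name X -> Prop) (e : nat -> name X) (A : form) : pt X -> Prop :=
  match A with
  | Fal => fun _ => False
  | Eq i j => eqn (e i) (e j)
  | Mem i j => mem (e i) (e j)
  | And B C => fun t => satD D e B t /\ satD D e C t
  | Or B C => fun t => satD D e B t \/ satD D e C t
  | Imp B C => fun t => near t (fun s => satD D e B s -> satD D e C s)
  | All B => fun t => near t (fun s => forall v, D v -> satD D (scons v e) B s)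
  | Ex B => fun t => exists v, D v /\ satD D (scons v e) B t
  end.

Definition every (v : name X) : Prop := True.
Notation sat := (satD every).

Lemma satD_ren D A : forall e f t,
  satD D e (ren f A) t <-> satD D (fun i => e (f i)) A t.
Proof.
  assert (Hup : forall e f v,
    (fun i => scons v e (up f i)) = scons v (fun i => e (f i))).
  { intros e f v; apply functional_extensionality; intros [|i]; reflexivity. }
  induction A as [ | | |B IB C IC|B IB C IC|B IB C IC|B IB|B IB];
    intros e f t; simpl; try reflexivity.
  - rewrite IB, IC; reflexivity.
  - rewrite IB, IC; reflexivity.
  - apply near_iff; intros s; rewrite IB, IC; reflexivity.
  - apply near_iff; intros s; split; intros H v Hv; specialize (H v Hv); revert H;
      rewrite IB, Hup; auto.
  - split; intros (v & Hv & H); exists v; split; auto; revert H;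
      rewrite IB, Hup; auto.
Qed.

(** Truth is open: this is what makes the introduction rules for implication and
    for the universal quantifier sound. *)
Lemma satD_near D A : forall e t, satD D e A t -> near t (satD D e A).
Proof.
  induction A as [ |i j|i j|B IB C IC|B IB C IC|B IB C IC|B IB|B IB];
    intros e t; simpl.
  - intros [].
  - apply eqn_near.
  - apply mem_near.
  - intros [HB HC]; apply near_and; auto.
  - intros [HB|HC]; [apply IB in HB; revert HB|apply IC in HC; revert HC];
      apply near_mono; auto.
  - apply near_near.
  - apply near_near.
  - intros (v & Hv & H); apply IB in H; revert H; apply near_mono; eauto.
Qed.

(** A hypothesis at [t] alone would not do, because there are infinitely many
    variables, and an infinite intersection of open sets need not be open. *)
Lemma sat_congr A : forall (e e' : nat -> name X) t,
  near t (fun s => forall i, eqn (e i) (e' i) s) -> sat e A t -> sat e' A t.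
Proof.
  assert (Hsym : forall (e e' : nat -> name X) t, near t (fun s => forall i, eqn (e i) (e' i) s) ->
    near t (fun s => forall i, eqn (e' i) (e i) s)).
  { intros e e' t; apply near_mono; intros s H i; apply eqn_sym, H. }
  assert (Hup : forall (e e' : nat -> name X) t v, near t (fun s => forall i, eqn (e i) (e' i) s) ->
    near t (fun s => forall i, eqn (scons v e i) (scons v e' i) s)).
  { intros e e' t v; apply near_mono; intros s H [|i]; simpl; auto.
    apply eqn_refl. }
  induction A as [ |i j|i j|B IB C IC|B IB C IC|B IB C IC|B IB|B IB];
    intros e e' t He; pose proof (near_here _ _ He) as Ht; simpl in *.
  - intros [].
  - intros H; apply eqn_trans with (e i); [apply eqn_sym, Ht|].
    apply eqn_trans with (e j); auto.
  - intros H; apply mem_eqn_l with (e i); auto.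
    apply mem_eqn_r with (e j); auto.
  - intros [HB HC]; eauto.
  - intros [HB|HC]; eauto.
  - intros H; apply (near_imp _ _ _ (near_and _ _ _ H (near_near _ _ He))).
    intros s [Hs Hes] HB; eauto.
  - intros H; apply (near_imp _ _ _ (near_and _ _ _ H (near_near _ _ He))).
    intros s [Hs Hes] v Hv; eauto.
  - intros (v & Hv & H); exists v; split; eauto.
Qed.

Lemma sat_scons_congr A e v v' t :
  eqn v v' t -> sat (scons v e) A t -> sat (scons v' e) A t.
Proof.
  intros H; apply sat_congr; apply eqn_near in H; revert H; apply near_mono.
  intros s H [|i]; simpl; [exact H|apply eqn_refl].
Qed.

Lemma near_forall_in (G : list form) e t :
  (forall B, In B G -> sat e B t) -> near t (fun s => forall B, In B G -> sat e B s).
Proof.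
  induction G as [|A G IH]; intros H.
  - apply near_top; intros s B [].
  - apply (near_imp _ _ _ (near_and _ _ _
      (satD_near every A e t (H A (or_introl eq_refl)))
      (IH (fun B HB => H B (or_intror HB))))).
    intros s [HA HG] B [<-|HB]; auto.
Qed.

Theorem soundness (T : form -> Prop) (HT : forall A, T A -> forall e t, sat e A t)
  (G : list form) (A : form) :
  prv intuitionistic T G A ->
  forall e t, (forall B, In B G -> sat e B t) -> sat e A t.
Proof.
  assert (Hshift : forall G e v s, (forall B, In B G -> sat e B s) ->
    forall B, In B (map shift G) -> sat (scons v e) B s).
  { intros G' e v s H B HB; apply in_map_iff in HB; destruct HB as (C & <- & HC).
    apply (satD_ren every C (scons v e) S s); apply H, HC. }
  assert (Hsub : forall B (i : nat) e s,
    sat e (subst0 i B) s <-> sat (scons (e i) e) B s).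
  { intros B i e s; unfold subst0; rewrite satD_ren.
    replace (fun k => e match k with 0 => i | S j => j end) with (scons (e i) e);
      [reflexivity|].
    apply functional_extensionality; intros [|k]; reflexivity. }
  intros H; induction H as
    [G A HA|G A HA|G A _ IH|G A B _ IA _ IB|G A B _ IH|G A B _ IH|G A B _ IH
    |G A B _ IH|G A B C _ IH _ IA _ IB|G A B _ IH|G A B _ IAB _ IA
    |G A _ IH|G A y _ IH|G A y _ IH|G A C _ IH _ IC|G x|G A x y _ IE _ IA
    |G A HL _ IH]; intros e t HG.
  - auto.
  - auto.
  - destruct (IH e t HG).
  - split; auto.
  - apply (IH e t HG).
  - apply (IH e t HG).
  - left; auto.
  - right; auto.
  - destruct (IH e t HG) as [HA|HB]; [apply IA|apply IB]; auto;
      intros D [<-|HD]; auto.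
  - apply (near_imp _ _ _ (near_forall_in _ _ _ HG)); intros s Hs HA.
    apply IH; intros D [<-|HD]; auto.
  - pose proof (near_here _ _ (IAB e t HG)) as K; apply K, IA, HG.
  - apply (near_imp _ _ _ (near_forall_in _ _ _ HG)); intros s Hs v _.
    apply IH, Hshift, Hs.
  - apply Hsub; pose proof (near_here _ _ (IH e t HG)) as K; apply K; exact I.
  - exists (e y); split; [exact I|]; apply Hsub, IH, HG.
  - destruct (IH e t HG) as (v & _ & Hv).
    assert (HC : sat (scons v e) (shift C) t).
    { apply IC; intros D [<-|HD]; [exact Hv|]; eapply Hshift; eauto. }
    apply (satD_ren every C (scons v e) S t) in HC; exact HC.
  - apply eqn_refl.
  - apply Hsub; apply sat_scons_congr with (e x); [apply (IE e t HG)|].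
    apply Hsub, IA, HG.
  - discriminate.
Qed.

End Forcing.

Arguments eqn {X}. Arguments mem {X}. Arguments elt {X}. Arguments scons {A}.
Arguments every {X}. Arguments satD {X}.
Notation sat := (satD every).

Section Sets.
Variable X : space.
Implicit Types (t s r : pt X) (x y z v w c : name X).

Definition idx y : Type := match y with Name J _ _ => J end.
Definition child y : idx y -> name X :=
  match y with Name J g v => g end.
Definition weight y : idx y -> pt X -> Prop :=
  match y with Name J g v => v end.

Lemma elt_char y t c :
  elt y t c <-> exists j : idx y, near t (weight y j) /\ c = child y j.
Proof. destruct y; reflexivity. Qed.

Lemma mem_char x y t :
  mem x y t <-> exists j : idx y, near t (weight y j) /\ eqn x (child y j) t.
Proof.
  split.
  - intros (c & Hc & E); apply elt_char in Hc; destruct Hc as (j & Hj & ->); eauto.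
  - intros (j & Hj & E); exists (child y j); split; [apply elt_char|]; eauto.
Qed.

Definition full (I : Type) (f : I -> name X) : name X := Name I f (fun _ _ => True).

Lemma mem_full I f x t : mem x (full I f) t <-> exists i, eqn x (f i) t.
Proof.
  rewrite mem_char; simpl; split; [firstorder|].
  intros [i E]; exists i; split; auto; apply near_top; auto.
Qed.

Definition emptyN : name X := full Empty_set (fun i => match i with end).
Definition upairN x y : name X := full bool (fun b => if b then x else y).
Definition succN x : name X :=
  Name (option (idx x)) (fun o => match o with Some i => child x i | None => x end)
    (fun o => match o with Some i => weight x i | None => fun _ => True end).
Definition unionN y : name X :=
  Name {i : idx y & idx (child y i)}
    (fun p => child (child y (projT1 p)) (projT2 p))
    (fun p s => near s (weight y (projT1 p)) /\
                near s (weight (child y (projT1 p)) (projT2 p))).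
Definition sepN y (P : name X -> pt X -> Prop) : name X :=
  Name (idx y) (child y) (fun i s => near s (weight y i) /\ P (child y i) s).

(** Up to equality a subset [z] of [y] is determined by the open sets on which
    the various members of [y] belong to it, so that the families of weights
    exhaust the subsets. *)
Definition powerN y : name X :=
  full (idx y -> pt X -> Prop) (fun h => sepN y (fun c s =>
    exists i, c = child y i /\ near s (h i))).

Definition numN (k : nat) : name X := Nat.iter k succN emptyN.
Definition omegaN : name X := full nat numN.

Lemma mem_empty x t : ~ mem x emptyN t.
Proof. unfold emptyN; rewrite mem_full; intros [[] _]. Qed.

Lemma mem_upair x y z t : mem z (upairN x y) t <-> eqn z x t \/ eqn z y t.
Proof.
  unfold upairN; rewrite mem_full; split.
  - intros [[|] H]; auto.
  - intros [H|H]; [exists true|exists false]; auto.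
Qed.

Lemma mem_succ x z t : mem z (succN x) t <-> mem z x t \/ eqn z x t.
Proof.
  unfold succN; rewrite !mem_char; simpl; split.
  - intros ([i|] & Hi & E); eauto.
  - intros [(i & Hi & E)|E]; [exists (Some i)|exists None]; simpl; auto.
    split; auto; apply near_top; auto.
Qed.

Lemma eqn_succ x y t : eqn x y t -> eqn (succN x) (succN y) t.
Proof.
  intros H; apply eqn_ext; apply eqn_near in H; revert H; apply near_mono.
  intros s H w; rewrite !mem_succ; split; (intros [K|K]; [left|right]).
  - apply mem_eqn_r with x; auto.
  - apply eqn_trans with x; auto.
  - apply mem_eqn_r with y; [apply eqn_sym|]; auto.
  - apply eqn_trans with y; [|apply eqn_sym]; auto.
Qed.

Lemma mem_union y z t : mem z (unionN y) t <-> exists c, mem c y t /\ mem z c t.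
Proof.
  unfold unionN; rewrite mem_char; simpl; split.
  - intros ([i j] & Hij & E); simpl in *.
    apply near_here in Hij; destruct Hij as [Hi Hj].
    exists (child y i); split; apply mem_char; [exists i|exists j]; split; auto.
    apply eqn_refl.
  - intros (c & Hc & Hz); apply mem_char in Hc; destruct Hc as (i & Hi & E).
    apply (mem_eqn_r _ _ _ _ _ E) in Hz; apply mem_char in Hz.
    destruct Hz as (j & Hj & E'); exists (existT _ i j); simpl; split; auto.
    apply near_and; apply near_near; auto.
Qed.

Lemma mem_sep y (P : name X -> pt X -> Prop) z t
  (Hopen : forall c t, P c t -> near t (P c))
  (Hcongr : forall c c' t, eqn c c' t -> P c t -> P c' t) :
  mem z (sepN y P) t <-> mem z y t /\ P z t.
Proof.
  unfold sepN; rewrite !mem_char; simpl; split.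
  - intros (i & Hi & E); apply near_here in Hi; destruct Hi as [Hi HP].
    split; eauto; apply Hcongr with (child y i); auto; apply eqn_sym; auto.
  - intros [(i & Hi & E) HP]; exists i; split; auto.
    apply near_and; [apply near_near; auto|]; eauto.
Qed.

Lemma mem_power y z t :
  mem z (powerN y) t <-> near t (fun s => forall w, mem w z s -> mem w y s).
Proof.
  unfold powerN; rewrite mem_full; split.
  - intros [h E]; apply eqn_ext in E; revert E; apply near_mono.
    intros s E w Hw; apply E, mem_char in Hw; destruct Hw as (i & Hi & E').
    simpl in Hi; apply near_here in Hi; apply mem_char; exists i; tauto.
  - intros H; exists (fun i => mem (child y i) z); apply eqn_ext.
    revert H; apply near_mono; intros s H w; split.
    + intros Hw; destruct (proj1 (mem_char _ _ _) (H w Hw)) as (i & Hi & E).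
      apply mem_char; exists i; split; auto; simpl; apply near_and.
      { apply near_near; auto. }
      pose proof (mem_near _ _ _ _ (mem_eqn_l _ _ _ _ _ E Hw)) as Hz.
      apply near_near in Hz; revert Hz; apply near_mono; eauto.
    + intros Hw; apply mem_char in Hw; destruct Hw as (i & Hi & E); simpl in *.
      apply near_here in Hi; destruct Hi as (_ & j & Ej & Hj).
      apply mem_eqn_l with (child y j); [|apply near_here; auto].
      rewrite <- Ej; apply eqn_sym; auto.
Qed.

Lemma mem_num k x t : mem x (numN k) t <-> exists j, j < k /\ eqn x (numN j) t.
Proof.
  induction k as [|k IH]; simpl.
  - split; [intros H; destruct (mem_empty _ _ H)|intros (j & Hj & _); lia].
  - rewrite mem_succ; fold (numN k); rewrite IH; split.
    + intros [(j & Hj & E)|E]; [exists j|exists k]; split; auto; lia.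
    + intros (j & Hj & E); assert (j < k \/ j = k) as [?| ->] by lia; eauto.
Qed.

(** * Validity of the axioms *)

Lemma sat_inst1 D (A : form) (i d : nat) (e : nat -> name X) t :
  satD D e (inst A [i] d) t <->
  satD D (scons (e (index d i)) (fun j => e (d + j))) A t.
Proof.
  unfold inst; rewrite satD_ren; cbv beta.
  match goal with |- satD _ ?f _ _ <-> satD _ ?g _ _ => replace f with g end;
    [reflexivity|].
  apply functional_extensionality; intros [|[|j]]; reflexivity.
Qed.

Definition valid (A : form) : Prop := forall e (t : pt X), sat e A t.

Ltac all_intro v :=
  apply near_top; let s := fresh "s" in intros s; intros v _.

Lemma extensionality_valid : valid ax_extensionality.
Proof.
  intros e t; unfold ax_extensionality; cbn.
  all_intro x; all_intro y; apply near_top; intros s1 H.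
  apply eqn_ext; apply (near_imp _ _ _ _ H); intros r K z.
  destruct (K z I) as [K1 K2]; split; [exact (near_here _ _ K1)|exact (near_here _ _ K2)].
Qed.

Lemma empty_valid : valid ax_empty.
Proof.
  intros e t; exists emptyN; split; [exact I|]; cbn.
  all_intro w; apply near_top; intros r; apply mem_empty.
Qed.

Lemma pairing_valid : valid ax_pairing.
Proof.
  intros e t; unfold ax_pairing; cbn.
  all_intro x; all_intro y; exists (upairN x y); split; [exact I|].
  exists x; split; [exact I|]; split; [apply eqn_refl|].
  exists y; split; [exact I|]; split; [apply eqn_refl|].
  all_intro w; split; apply near_top; intros r; apply mem_upair.
Qed.

Lemma union_valid : valid ax_union.
Proof.
  intros e t; unfold ax_union; cbn.
  all_intro x; exists (unionN x); split; [exact I|].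
  all_intro w; split; apply near_top; intros r; rewrite mem_union;
    intros (c & H); exists c; unfold every in *; cbn in *; tauto.
Qed.

Lemma infinity_valid : valid ax_infinity.
Proof.
  intros e t; exists omegaN; split; [exact I|]; cbn; split.
  - exists emptyN; split; [exact I|]; split.
    + all_intro w; apply near_top; intros r; apply mem_empty.
    + exists omegaN; split; [exact I|]; split; [apply eqn_refl|].
      apply mem_full; exists 0; apply eqn_refl.
  - all_intro x; apply near_top; intros r Hx.
    apply mem_full in Hx; destruct Hx as [k Hk].
    exists (succN x); split; [exact I|]; split.
    + exists x; split; [exact I|]; split; [apply eqn_refl|].
      all_intro w; split; apply near_top; intros q; apply mem_succ.
    + exists omegaN; split; [exact I|]; split; [apply eqn_refl|].
      apply mem_full; exists (S k); apply eqn_succ, Hk.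
Qed.

Lemma power_valid : valid ax_power.
Proof.
  intros e t; unfold ax_power; cbn.
  all_intro x; exists (powerN x); split; [exact I|].
  all_intro z; split; apply near_top; intros r.
  - intros H; apply mem_power in H; revert H; apply near_open; intros q Hq w _.
    apply (near_imp _ _ _ _ Hq); auto.
  - intros H; apply mem_power; revert H; apply near_mono; intros q Hq w.
    exact (near_here _ _ (Hq w I)).
Qed.

Lemma induction_valid A : valid (ax_induction A).
Proof.
  intros e t; unfold ax_induction; cbn.
  apply near_top; intros s H; apply near_near in H; revert H; apply near_mono.
  intros r H v _; revert r H; induction v as [J g IH w]; intros r H.
  pose proof (near_here _ _ H (Name J g w) I) as K.
  apply near_here in K; apply K; clear K.
  revert H; apply near_open; intros q Hq y _.
  apply near_near in Hq; revert Hq; apply near_mono; intros p Hp Hy.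
  apply mem_char in Hy; destruct Hy as (j & Hj & E).
  specialize (IH j p Hp); apply sat_inst1 in IH; apply sat_inst1; revert IH; cbn.
  apply sat_scons_congr, eqn_sym, E.
Qed.

Lemma separation_valid A : valid (ax_separation A).
Proof.
  intros e t; unfold ax_separation; cbn.
  all_intro z.
  set (P := fun v => sat (scons v e) A).
  exists (sepN z P); split; [exact I|].
  assert (HP : forall x r, mem x (sepN z P) r <-> mem x z r /\ P x r).
  { intros x r; apply mem_sep.
    - intros; apply satD_near; assumption.
    - intros c c' q E; apply sat_scons_congr, E. }
  all_intro x; split; apply near_top; intros r; rewrite HP.
  - intros [H1 H2]; split; [exact H1|]; apply sat_inst1; exact H2.
  - intros [H1 H2]; split; [exact H1|]; apply sat_inst1 in H2; exact H2.
Qed.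

(** ** Reflection *)

Definition listed Z v : Prop := exists k : idx Z, v = child Z k.

(** All members of [full K g] are present everywhere, so that quantifying over
    its elements amounts to quantifying over the family [g], in the sense of the
    metatheory. *)
Lemma sat_relativize (A : form) : forall (K : Type) (g : K -> name X) e (z : nat) t,
  e z = full K g ->
  (sat e (relativize z A) t <-> satD (listed (full K g)) e A t).
Proof.
  induction A as [ | | |B IB C IC|B IB C IC|B IB C IC|B IB|B IB];
    intros K g e z t Hz; cbn [relativize satD]; try reflexivity.
  - rewrite (IB K g), (IC K g) by exact Hz; reflexivity.
  - rewrite (IB K g), (IC K g) by exact Hz; reflexivity.
  - apply near_iff; intros s; rewrite (IB K g), (IC K g) by exact Hz; reflexivity.
  - split; intros H.
    + apply (near_imp _ _ _ _ H); clear H; intros s H v [k ->].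
      specialize (H (child (full K g) k) I).
      apply near_here in H; rewrite (IB K g) in H by exact Hz; apply H.
      cbn; rewrite Hz; apply mem_full; exists k; apply eqn_refl.
    + revert H; apply near_open; intros s H v _.
      apply (near_imp _ _ _ _ H); clear H; intros r H Hv.
      cbn in Hv; rewrite Hz in Hv; apply mem_full in Hv; destruct Hv as [k E].
      apply sat_scons_congr with (g k); [apply eqn_sym, E|].
      rewrite (IB K g) by exact Hz; apply H; exists k; reflexivity.
  - split.
    + intros (v & _ & Hv & H); cbn in Hv; rewrite Hz in Hv.
      apply mem_full in Hv; destruct Hv as [k E].
      exists (g k); split; [exists k; reflexivity|].
      rewrite <- (IB K g) with (z := S z) by exact Hz; revert H.
      apply sat_scons_congr, E.
    + intros (v & [k ->] & H); exists (g k); split; [exact I|]; split.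
      * cbn; rewrite Hz; apply mem_full; exists k; apply eqn_refl.
      * rewrite (IB K g) by exact Hz; exact H.
Qed.

(** Only finitely many variables are bound at any place of a formula; the
    parameters of the schema form the fixed tail [e]. *)
Definition prefix (l : list (name X)) (e : nat -> name X) : nat -> name X :=
  fold_right scons e l.

Definition witness (P : name X -> Prop) : name X := epsilon (inhabits emptyN) P.

Lemma witness_spec (P : name X -> Prop) v : P v -> P (witness P).
Proof. intros H; apply (epsilon_spec (inhabits emptyN) P); eauto. Qed.

(** One step adds the children of all names present, for transitivity, and for
    each formula, each tuple of names present and each point a witness of an
    existential statement and a counterexample to a universal one.  Since tuples
    are finite, countably many steps suffice. *)
Definition hull_step (e : nat -> name X) Z : name X :=
  full (idx Z + {k : idx Z & idx (child Z k)} +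
        (form * list (idx Z) * pt X) * bool)
    (fun o => match o with
     | inl (inl k) => child Z k
     | inl (inr p) => child (child Z (projT1 p)) (projT2 p)
     | inr ((A, l, t), b) =>
         let P v := sat (scons v (prefix (map (child Z) l) e)) A t in
         witness (if b then P else fun v => ~ P v)
     end).

Definition hull_stage (e : nat -> name X) z (n : nat) : name X :=
  Nat.iter n (hull_step e)
    (full (option nat) (fun o => match o with Some i => e i | None => z end)).

Definition hull (e : nat -> name X) z : name X :=
  full {n : nat & idx (hull_stage e z n)}
    (fun p => child (hull_stage e z (projT1 p)) (projT2 p)).

Section Hull.
Variables (e : nat -> name X) (z : name X).
Notation stage := (hull_stage e z).
Notation Z := (hull e z).

Lemma listed_hull v : listed Z v <-> exists n, listed (stage n) v.
Proof.
  split.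
  - intros [[n k] ->]; exists n, k; reflexivity.
  - intros (n & k & ->); exists (existT _ n k); reflexivity.
Qed.

Lemma listed_stage_mono n m v : n <= m -> listed (stage n) v -> listed (stage m) v.
Proof.
  intros H; induction H as [|m H IH]; auto; intros Hv.
  destruct (IH Hv) as [k ->]; exists (inl (inl k)); reflexivity.
Qed.

Lemma listed_prefix (l : list (name X)) : (forall v, In v l -> listed Z v) ->
  exists n (l' : list (idx (stage n))), l = map (child (stage n)) l'.
Proof.
  intros H; assert (exists n, forall v, In v l -> listed (stage n) v) as [n Hn].
  { induction l as [|v l IH]; [exists 0; intros v []|].
    destruct IH as [n Hn]; [intros; apply H; right; assumption|].
    destruct (proj1 (listed_hull v) (H v (or_introl eq_refl))) as [m Hm].
    exists (n + m); intros u [<-|Hu];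
      [apply listed_stage_mono with m|apply listed_stage_mono with n]; auto; lia. }
  exists n; clear H; induction l as [|v l IH]; [exists []; reflexivity|].
  destruct IH as [l' ->]; [intros; apply Hn; right; assumption|].
  destruct (Hn v (or_introl eq_refl)) as [k ->]; exists (k :: l'); reflexivity.
Qed.

Lemma hull_witness (A : form) (l : list (name X)) t (b : bool) :
  (forall v, In v l -> listed Z v) ->
  let P v := sat (scons v (prefix l e)) A t in
  let Q := if b then P else fun v => ~ P v in
  forall v, Q v -> exists v, listed Z v /\ Q v.
Proof.
  intros Hl P Q v Hv; destruct (listed_prefix l Hl) as (n & l' & ->).
  exists (witness Q); split; [|apply witness_spec with v, Hv].
  apply listed_hull; exists (S n), (inr ((A, l', t), b)); destruct b; reflexivity.
Qed.

(** The Tarski-Vaught criterion, at each point separately. *)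
Lemma hull_reflects (A : form) : forall (l : list (name X)) t,
  (forall v, In v l -> listed Z v) ->
  (satD (listed Z) (prefix l e) A t <-> sat (prefix l e) A t).
Proof.
  assert (Hcons : forall l v, listed Z v -> (forall u, In u l -> listed Z u) ->
    forall u, In u (v :: l) -> listed Z u).
  { intros l v Hv Hl u [<-|Hu]; auto. }
  induction A as [ | | |B IB C IC|B IB C IC|B IB C IC|B IB|B IB];
    intros l t Hl; cbn [satD]; try reflexivity.
  - rewrite IB, IC by assumption; reflexivity.
  - rewrite IB, IC by assumption; reflexivity.
  - apply near_iff; intros s; rewrite IB, IC by assumption; reflexivity.
  - apply near_iff; intros s; split; intros H v Hv.
    + apply NNPP; intros HN.
      destruct (hull_witness B l s false Hl v HN) as (u & Hu & HNu).
      apply HNu; apply (IB (u :: l) s (Hcons l u Hu Hl)), H, Hu.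
    + apply (IB (v :: l) s (Hcons l v Hv Hl)), H; exact I.
  - split; intros (v & Hv & H).
    + exists v; split; [exact I|]; apply (IB (v :: l) t (Hcons l v Hv Hl)), H.
    + destruct (hull_witness B l t true Hl v H) as (u & Hu & H').
      exists u; split; auto; apply (IB (u :: l) t (Hcons l u Hu Hl)), H'.
Qed.

Lemma mem_hull v t : mem v Z t <-> exists u, listed Z u /\ eqn v u t.
Proof.
  split.
  - intros H; apply mem_full in H; destruct H as [k E].
    exists (child Z k); split; [exists k; reflexivity|exact E].
  - intros (u & [k ->] & E); apply mem_full; exists k; exact E.
Qed.

Lemma hull_transitive u v t : mem v Z t -> mem u v t -> mem u Z t.
Proof.
  intros Hv Hu; apply mem_hull in Hv; destruct Hv as (y & Hy & E).
  apply (mem_eqn_r _ _ _ _ _ E), mem_char in Hu; destruct Hu as (j & _ & Ej).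
  apply mem_hull; exists (child y j); split; auto.
  apply listed_hull in Hy; destruct Hy as (n & k & ->).
  apply listed_hull; exists (S n), (inl (inr (existT _ k j))); reflexivity.
Qed.

Lemma hull_base t : mem z Z t /\ forall i, mem (e i) Z t.
Proof.
  split; [|intros i]; apply mem_hull; eexists; (split; [|apply eqn_refl]);
    apply listed_hull; exists 0; [exists None|exists (Some i)]; reflexivity.
Qed.

End Hull.

Lemma reflection_valid A : valid (ax_reflection A).
Proof.
  intros e t; unfold ax_reflection, closed, fall at 1; cbn [satD].
  all_intro z; exists (hull e z); split; [exact I|].
  split; [|split; [|split]].
  - cbn; all_intro y; apply near_top; intros r1 Hy; apply mem_near in Hy.
    revert Hy; apply near_open; intros q Hq u _; revert Hq; apply near_mono.
    intros p Hp Hu; exact (hull_transitive e z _ _ _ Hp Hu).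
  - exact (proj1 (hull_base e z s)).
  - unfold params_in; induction (lower (fv A)) as [|i l IH]; cbn [fold_right].
    + apply near_top; auto.
    + split; [exact (proj2 (hull_base e z s) i)|exact IH].
  - all_intro v.
    (* [v] is merely equal to a listed member, and on a neighbourhood only, so
       it is replaced by that member before reflection applies. *)
    assert (K : forall r, mem v (hull e z) r ->
      (sat (scons v (scons (hull e z) (scons z e))) (inst A [2] 3) r <->
       sat (scons v (scons (hull e z) (scons z e)))
         (relativize 1 (inst A [2] 3)) r)).
    { intros r Hv; apply mem_hull in Hv; destruct Hv as (u & Hu & E).
      transitivity (sat (scons u (scons (hull e z) (scons z e)))
         (inst A [2] 3) r).
      { split; apply sat_scons_congr; [|apply eqn_sym]; exact E. }
      transitivity (sat (scons u (scons (hull e z) (scons z e)))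
         (relativize 1 (inst A [2] 3)) r).
      2: { split; apply sat_scons_congr; [apply eqn_sym|]; exact E. }
      rewrite sat_relativize by reflexivity; rewrite !sat_inst1.
      symmetry; apply (hull_reflects e z A [u] r).
      intros w [<-|[]]; exact Hu. }
    cbn; apply near_top; intros r0 Hv.
    split; apply (near_imp _ _ _ _ (mem_near _ _ _ _ Hv)); intros r Hr;
      apply (K r Hr).
Qed.

Theorem IZF_Ref_valid A : IZF_Ref A -> valid A.
Proof.
  intros []; [apply extensionality_valid|apply empty_valid|apply pairing_valid
    |apply union_valid|apply infinity_valid|apply power_valid
    |apply induction_valid|apply separation_valid|apply reflection_valid].
Qed.

End Sets.

Arguments emptyN {X}. Arguments upairN {X}. Arguments succN {X}. Arguments numN {X}.
Arguments omegaN {X}. Arguments full {X}. Arguments valid {X}.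

(** * Formulas with named binders *)

Section Internal.
Variable X : space.
Implicit Types (t s r : pt X) (u v w : name X) (e l : list (name X)).

(** The list [e] is read from the innermost binder outwards, as for indices; a
    level counts from the other end of [e].  Thus a level keeps its meaning when
    further binders are passed, and the next binder has level [length e]. *)
Definition env e (i : nat) : name X := nth i e emptyN.
Definition lk e (x : lvl) : name X := env e (length e - S x).
Definition hold e (F : fm) : pt X -> Prop := sat (env e) (F (length e)).

Lemma lk_here e v x : x = length e -> lk (v :: e) x = v.
Proof.
  intros ->; unfold lk; cbn [length].
  replace (S (length e) - S (length e)) with 0 by lia; reflexivity.
Qed.

Lemma lk_there e v x : x < length e -> lk (v :: e) x = lk e x.
Proof.
  intros H; unfold lk; cbn [length].
  replace (S (length e) - S x) with (S (length e - S x)) by lia; reflexivity.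
Qed.

Lemma lk_app l e x : x < length e -> lk (l ++ e) x = lk e x.
Proof.
  intros H; induction l as [|v l IH]; [reflexivity|].
  cbn [app]; rewrite lk_there; [exact IH|rewrite length_app; lia].
Qed.

Lemma env_cons e v : env (v :: e) = scons v (env e).
Proof. apply functional_extensionality; intros [|i]; reflexivity. Qed.

Lemma hold_near e F t : hold e F t -> near t (hold e F).
Proof. apply satD_near. Qed.

Lemma hold_congr e e' F t :
  Forall2 (fun v v' => eqn v v' t) e e' -> hold e F t -> hold e' F t.
Proof.
  intros H; unfold hold.
  assert (length e = length e') as <- by (induction H; cbn; congruence).
  apply sat_congr; induction H as [|v v' e e' Hv H IH].
  - apply near_top; intros s i; apply eqn_refl.
  - apply (near_imp _ _ _ _ (near_and _ _ _ (eqn_near _ _ _ _ Hv) IH)).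
    intros s [Hs Hi]; rewrite !env_cons; intros [|i]; cbn; auto.
Qed.

Lemma Forall2_eqn_refl e t : Forall2 (fun v v' => eqn v v' t) e e.
Proof. induction e; constructor; auto; apply eqn_refl. Qed.

Lemma hold_congr1 e v v' F t : eqn v v' t -> hold (v :: e) F t -> hold (v' :: e) F t.
Proof.
  intros H; apply hold_congr; constructor; [exact H|apply Forall2_eqn_refl].
Qed.

Lemma hold_eq e x y t : hold e (feq x y) t <-> eqn (lk e x) (lk e y) t.
Proof. reflexivity. Qed.
Lemma hold_mem e x y t : hold e (fmem x y) t <-> mem (lk e x) (lk e y) t.
Proof. reflexivity. Qed.
Lemma hold_and e F G t : hold e (fand F G) t <-> hold e F t /\ hold e G t.
Proof. reflexivity. Qed.
Lemma hold_or e F G t : hold e (for_ F G) t <-> hold e F t \/ hold e G t.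
Proof. reflexivity. Qed.
Lemma hold_imp e F G t :
  hold e (fimp F G) t <-> near t (fun s => hold e F s -> hold e G s).
Proof. reflexivity. Qed.
Lemma hold_not e F t :
  hold e (fimp F ffal) t <-> near t (fun s => ~ hold e F s).
Proof. reflexivity. Qed.

Lemma hold_all e G t :
  hold e (fall G) t <-> near t (fun s => forall v, hold (v :: e) (G (length e)) s).
Proof.
  unfold hold, fall; cbn [satD length].
  split; apply near_mono; intros s H v; specialize (H v);
    rewrite env_cons in *; auto; apply H; exact I.
Qed.

Lemma hold_ex e G t :
  hold e (fex G) t <-> exists v, hold (v :: e) (G (length e)) t.
Proof.
  unfold hold, fex; cbn [satD length].
  split; [intros (v & _ & H)|intros [v H]]; exists v; rewrite env_cons in *; auto.
  split; [exact I|exact H].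
Qed.

Lemma hold_all_imp e A G t :
  hold e (∀ x, A x ⇒ G x)%fm t <->
  near t (fun s => forall v, hold (v :: e) (A (length e)) s ->
                             hold (v :: e) (G (length e)) s).
Proof.
  rewrite hold_all; split.
  - apply near_mono; intros s H v Hv; specialize (H v).
    rewrite hold_imp in H; exact (near_here _ _ H Hv).
  - apply near_open; intros s H v; rewrite hold_imp; revert H; apply near_mono; auto.
Qed.

Lemma hold_all_iff e A G t :
  hold e (∀ x, A x ⇔ G x)%fm t <->
  near t (fun s => forall v, hold (v :: e) (A (length e)) s <->
                             hold (v :: e) (G (length e)) s).
Proof.
  rewrite hold_all; split.
  - apply near_mono; intros s H v; specialize (H v); unfold fiff in H.
    rewrite hold_and, !hold_imp in H; destruct H as [H1 H2]; split;
      [exact (near_here _ _ H1)|exact (near_here _ _ H2)].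
  - apply near_open; intros s H v; unfold fiff; rewrite hold_and, !hold_imp.
    split; revert H; apply near_mono; intros r H; apply H.
Qed.

(** ** Denotations of definable terms *)

(** A term is known by its graph, hence it has a value at [t] if the graph is
    equality with that value there.  The list [l] makes the notion stable under
    further binders.  Equality is required at the point [t] alone, because the
    value of an application may change from one point to another. *)
Definition den (a : tm) e v t : Prop := forall l z, z < length (l ++ e) ->
  (hold (l ++ e) (a z) t <-> eqn (lk (l ++ e) z) v t).

Lemma den_app a l e v t : den a e v t -> den a (l ++ e) v t.
Proof.
  intros H l' z; specialize (H (l' ++ l) z); rewrite <- app_assoc in H; exact H.
Qed.

Lemma den_cons a e u v t : den a e v t -> den a (u :: e) v t.
Proof. exact (den_app a [u] e v t). Qed.

Lemma den_eqn a e v v' t : eqn v v' t -> den a e v t -> den a e v' t.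
Proof.
  intros E H l z Hz; rewrite (H l z Hz); split; intros K.
  - apply eqn_trans with v; auto.
  - apply eqn_trans with v'; auto; apply eqn_sym; auto.
Qed.

Lemma den_unfold a e v t z : den a e v t -> z < length e ->
  (hold e (a z) t <-> eqn (lk e z) v t).
Proof. intros H; exact (H [] z). Qed.

Lemma den_var e x t : x < length e -> den (var x) e (lk e x) t.
Proof. intros H l z Hz; unfold var; rewrite hold_eq, (lk_app l e x H); reflexivity. Qed.

Lemma den_var_eq e x t v : x < length e -> lk e x = v -> den (var x) e v t.
Proof. intros H <-; apply den_var, H. Qed.

Lemma hold_bind a e v F t : den a e v t ->
  (hold e (bind a F) t <-> hold (v :: e) (F (length e)) t).
Proof.
  intros H; unfold bind; rewrite hold_ex; split.
  - intros (u & Hu); rewrite hold_and in Hu; destruct Hu as [Hu HF].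
    rewrite (den_unfold a _ v) in Hu by (cbn; auto using den_cons).
    rewrite lk_here in Hu by reflexivity; apply (hold_congr1 _ u); auto.
  - intros HF; exists v; rewrite hold_and; split; auto.
    rewrite (den_unfold a _ v) by (cbn; auto using den_cons).
    rewrite lk_here by reflexivity; apply eqn_refl.
Qed.

Lemma hold_bind_ex a e F t : hold e (bind a F) t ->
  exists v, hold (v :: e) (a (length e)) t /\ hold (v :: e) (F (length e)) t.
Proof. unfold bind; rewrite hold_ex; intros [v H]; exists v; exact H. Qed.

(** Extensionality: how a set that is specified by its elements is recognized. *)
Lemma hold_ext e z c G t : z < length e ->
  (forall s w, mem w c s <-> hold (w :: e) (G (length e)) s) ->
  (hold e (∀ n, n ∈ z ⇔ G n)%fm t <-> eqn (lk e z) c t).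
Proof.
  intros Hz H; rewrite hold_all_iff, eqn_ext.
  split; apply near_mono; intros s K v; specialize (K v);
    rewrite hold_mem, lk_here, lk_there in * by auto; rewrite H in *; exact K.
Qed.

End Internal.

Arguments hold {X}. Arguments lk {X}. Arguments den {X}. Arguments env {X}.

Ltac len := cbn [length app]; first
  [lia | repeat (progress (rewrite ?length_app in *; cbn [length app] in *)); lia].
Ltac lks := repeat first [rewrite lk_here by len | rewrite lk_there by len
  | rewrite lk_app by len].
Ltac lks_in H := repeat first [rewrite lk_here in H by len
  | rewrite lk_there in H by len | rewrite lk_app in H by len].
Ltac dvar := apply den_var_eq; [len|cbn [app]; lks; reflexivity].

Section Terms.
Variable X : space.
Implicit Types (t s r : pt X) (u v w : name X) (e l : list (name X)).

Definition opairN u v : name X := upairN (upairN u u) (upairN u v).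

Lemma eqn_iff_r u v w t : eqn v w t -> (eqn u v t <-> eqn u w t).
Proof.
  intros E; split; intros H; [apply eqn_trans with v|apply eqn_trans with w]; auto.
  apply eqn_sym; auto.
Qed.

Lemma eqn_upair u v u' v' t : eqn (upairN u v) (upairN u' v') t <->
  (eqn u u' t /\ eqn v v' t) \/ (eqn u v' t /\ eqn v u' t).
Proof.
  split.
  - intros H; apply eqn_ext, near_here in H.
    pose proof (fun z => iff_trans (iff_sym (mem_upair X u v z t))
      (iff_trans (H z) (mem_upair X u' v' z t))) as K; clear H.
    destruct (proj1 (K u) (or_introl (eqn_refl _ _ _))) as [E1|E1],
      (proj1 (K v) (or_intror (eqn_refl _ _ _))) as [E2|E2]; auto.
    + destruct (proj2 (K v') (or_intror (eqn_refl _ _ _))) as [E3|E3].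
      * right; split; auto; apply eqn_sym; auto.
      * left; split; auto; apply eqn_sym; auto.
    + destruct (proj2 (K u') (or_introl (eqn_refl _ _ _))) as [E3|E3].
      * left; split; auto; apply eqn_sym; auto.
      * right; split; auto; apply eqn_sym; auto.
  - assert (HT : forall a b c d, eqn a c t -> eqn b d t ->
      eqn (upairN a b) (upairN c d) t /\ eqn (upairN a b) (upairN d c) t).
    { intros a b c d H1 H2; split; apply eqn_ext;
        apply (near_imp _ _ _ _ (near_and _ _ _ (eqn_near _ _ _ _ H1)
          (eqn_near _ _ _ _ H2)));
        intros s [E1 E2] z; rewrite !mem_upair;
        pose proof (eqn_iff_r z _ _ _ E1); pose proof (eqn_iff_r z _ _ _ E2);
        tauto. }
    intros [[H1 H2]|[H1 H2]];
      [exact (proj1 (HT _ _ _ _ H1 H2))|exact (proj2 (HT _ _ _ _ H1 H2))].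
Qed.

Lemma eqn_opair u v u' v' t : eqn (opairN u v) (opairN u' v') t <->
  eqn u u' t /\ eqn v v' t.
Proof.
  unfold opairN; rewrite !eqn_upair; split; [|tauto].
  intros H; assert (E : eqn u u' t) by tauto; split; auto.
  destruct H as [[_ [[_ H]|[H1 H2]]]|[[[H1 H2]|[H1 H2]] [[H3 H4]|[H3 H4]]]]; auto.
  - apply eqn_trans with u'; auto; apply eqn_trans with u; auto; apply eqn_sym; auto.
  - apply eqn_trans with u'; auto; apply eqn_trans with u; auto; apply eqn_sym; auto.
  - apply eqn_trans with u'; auto; apply eqn_trans with u; auto; apply eqn_sym; auto.
  - apply eqn_trans with u'; auto; apply eqn_trans with u; auto; apply eqn_sym; auto.
  - apply eqn_trans with u'; auto; apply eqn_trans with u; auto; apply eqn_sym; auto.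
Qed.

Lemma den_empty e t : den empty e emptyN t.
Proof.
  intros l z Hz; unfold empty; rewrite hold_all, eqn_ext.
  split; apply near_open; intros s H.
  - intros w; apply near_here in H; specialize (H w).
    rewrite hold_not in H; apply near_here in H; rewrite hold_mem in H; lks_in H.
    split; [intros K; contradiction|intros K; destruct (mem_empty _ _ _ K)].
  - intros w; rewrite hold_not; revert H; apply near_mono; intros r H.
    rewrite hold_mem; lks; rewrite H; apply mem_empty.
Qed.

Lemma den_succ a e v t : den a e v t -> den (succ a) e (succN v) t.
Proof.
  intros H l z Hz; unfold succ; rewrite (hold_bind _ _ _ v) by (apply den_app, H).
  rewrite hold_ext with (c := succN v); [lks; reflexivity|len|].
  intros s w; rewrite mem_succ, hold_or, hold_mem, hold_eq; lks; reflexivity.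
Qed.

Lemma den_upair a b e u v t :
  den a e u t -> den b e v t -> den (upair a b) e (upairN u v) t.
Proof.
  intros Ha Hb l z Hz; unfold upair.
  rewrite (hold_bind _ _ _ u) by (apply den_app, Ha).
  rewrite (hold_bind _ _ _ v) by (apply den_cons, den_app, Hb).
  rewrite hold_ext with (c := upairN u v); [lks; reflexivity|len|].
  intros s w; rewrite mem_upair, hold_or, !hold_eq; lks; reflexivity.
Qed.

Lemma den_opair a b e u v t :
  den a e u t -> den b e v t -> den (opair a b) e (opairN u v) t.
Proof.
  intros Ha Hb l z Hz; unfold opair.
  rewrite (hold_bind _ _ _ u) by (apply den_app, Ha).
  rewrite (hold_bind _ _ _ v) by (apply den_cons, den_app, Hb).
  rewrite den_unfold with (v := opairN u v); [lks; reflexivity| |len].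
  repeat apply den_upair; dvar.
Qed.

Lemma hold_tmem a b e u v t :
  den a e u t -> den b e v t -> (hold e (tmem a b) t <-> mem u v t).
Proof.
  intros Ha Hb; unfold tmem.
  rewrite (hold_bind _ _ _ u) by (apply Ha).
  rewrite (hold_bind _ _ _ v) by (apply den_cons, Hb).
  rewrite hold_mem; lks; reflexivity.
Qed.

Lemma hold_teq a b e u v t :
  den a e u t -> den b e v t -> (hold e (teq a b) t <-> eqn u v t).
Proof.
  intros Ha Hb; unfold teq.
  rewrite (hold_bind _ _ _ u) by (apply Ha).
  rewrite (hold_bind _ _ _ v) by (apply den_cons, Hb).
  rewrite hold_eq; lks; reflexivity.
Qed.

(** ** Classes and functions *)

(** The class [A] has the meaning [P], independently of the context in which it
    occurs. *)
Definition cls (A : lvl -> fm) (P : name X -> pt X -> Prop) : Prop :=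
  forall e x t, x < length e -> (hold e (A x) t <-> P (lk e x) t).

(** The classes of natural and of rational numbers have only standard members,
    in the sense that every member is, at each point, equal to one from a fixed
    family [c] of names. *)
Definition range {I : Type} (c : I -> name X) v t : Prop := exists i, eqn v (c i) t.

Lemma cls_iff A P e x t : cls A P -> x < length e ->
  (hold e (A x) t <-> P (lk e x) t).
Proof. intros H; apply H. Qed.

Lemma cls_near A P v t : cls A P -> P v t -> near t (P v).
Proof.
  intros H Hv; pose proof (fun s => H [v] 0 s (le_n 1)) as K.
  apply (K t), hold_near in Hv; revert Hv; apply near_mono; intros s; apply K.
Qed.

Lemma cls_congr A P v v' t : cls A P -> eqn v v' t -> P v t -> P v' t.
Proof.
  intros H E Hv; apply (H [v'] 0 t (le_n 1)); apply (hold_congr1 _ _ v); auto.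
  apply (H [v] 0 t (le_n 1)); auto.
Qed.

Lemma hold_all_range {I : Type} A (c : I -> name X) e G t : cls A (range c) ->
  (hold e (∀ x, A x ⇒ G x)%fm t <->
   near t (fun s => forall i, hold (c i :: e) (G (length e)) s)).
Proof.
  intros H; rewrite hold_all_imp; split; apply near_mono; intros s K.
  - intros i; apply K; apply H; [len|]; lks; exists i; apply eqn_refl.
  - intros v Hv; apply H in Hv; [|len]; lks_in Hv; destruct Hv as [i E].
    apply (hold_congr1 _ _ (c i)); auto; apply eqn_sym; auto.
Qed.

Lemma hold_ex_range {I : Type} A (c : I -> name X) e G t : cls A (range c) ->
  (hold e (∃ x, A x ∧ G x)%fm t <->
   exists i, hold (c i :: e) (G (length e)) t).
Proof.
  intros H; rewrite hold_ex; split.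
  - intros (v & Hv & HG); apply H in Hv; [|len]; lks_in Hv; destruct Hv as [i E].
    exists i; apply (hold_congr1 _ _ v); auto.
  - intros [i Hi]; exists (c i); rewrite hold_and; split; auto.
    apply H; [len|]; lks; exists i; apply eqn_refl.
Qed.

Definition val (F : name X) u v t : Prop :=
  mem (opairN u v) F t /\ forall v', mem (opairN u v') F t -> eqn v' v t.

Definition FunS (P Q : name X -> pt X -> Prop) (F : name X) t : Prop :=
  near t (fun s =>
    (forall p, mem p F s -> exists x y, P x s /\ Q y s /\ eqn p (opairN x y) s) /\
    (forall x, P x s -> exists y, val F x y s)).

(** Membership in [F] persists by openness; uniqueness persists because [F]
    remains a function nearby. *)
Lemma val_near P Q F u v t :
  FunS P Q F t -> near t (P u) -> val F u v t -> near t (val F u v).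
Proof.
  intros HF Hu [Hm _].
  apply (near_imp _ _ _ _ (near_and _ _ _ HF (near_and _ _ _ Hu
    (mem_near _ _ _ _ Hm)))); intros s ((_ & H) & Hu' & Hm'); split; auto.
  destruct (H u Hu') as (y & _ & Hy); intros v' Hv'.
  apply eqn_trans with y; auto; apply eqn_sym; auto.
Qed.

Lemma cls_Fun A B P Q : cls A P -> cls B Q -> cls (Fun A B) (FunS P Q).
Proof.
  intros HA HB e f t Hf; unfold Fun; rewrite hold_and, !hold_all_imp.
  split.
  - intros [H1 H2]; apply (near_imp _ _ _ _ (near_and _ _ _ H1 H2)).
    clear H1 H2; intros s [H1 H2]; split.
    + intros p Hp; specialize (H1 p); rewrite hold_mem in H1; lks_in H1.
      apply H1, hold_ex in Hp; destruct Hp as [x Hp].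
      apply hold_ex in Hp; destruct Hp as [y Hp].
      rewrite !hold_and in Hp; destruct Hp as (Hx & Hy & Hp).
      apply HA in Hx; [|len]; apply HB in Hy; [|len]; lks_in Hx; lks_in Hy.
      apply (den_unfold _ _ _ (opairN x y)) in Hp;
        [|apply den_opair; dvar|len]; lks_in Hp; eauto.
    + intros x Hx; specialize (H2 x).
      assert (Hx' : hold (x :: e) (A (length e)) s) by (apply HA; [len|lks; exact Hx]).
      apply H2, hold_ex in Hx'; destruct Hx' as [y Hy]; rewrite hold_and, hold_all_imp in Hy.
      destruct Hy as [Hm Hu]; apply near_here in Hu; exists y; split.
      * apply (hold_tmem _ _ _ (opairN x y) (lk e f)) in Hm; auto;
          [apply den_opair|]; dvar.
      * intros y' Hy'; specialize (Hu y').
        rewrite (hold_tmem _ _ _ (opairN x y') (lk e f)), hold_eq in Hu;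
          [lks_in Hu; auto|apply den_opair|]; dvar.
  - intros H; split; revert H; apply near_open; intros s H.
    + apply near_here in H; destruct H as [H _]; intros p Hp.
      rewrite hold_mem in Hp; lks_in Hp; destruct (H p Hp) as (x & y & Hx & Hy & E).
      rewrite hold_ex; exists x; rewrite hold_ex; exists y; rewrite !hold_and.
      split; [apply HA; [len|lks; exact Hx]|].
      split; [apply HB; [len|lks; exact Hy]|].
      apply (den_unfold _ _ _ (opairN x y)); [apply den_opair; dvar|len|].
      lks; exact E.
    + intros x Hx; apply HA in Hx; [|len]; lks_in Hx.
      destruct (proj2 (near_here _ _ H) x Hx) as (y & Hy).
      pose proof (val_near _ _ _ _ _ _ H (cls_near _ _ _ _ HA Hx) Hy) as Hn.
      rewrite hold_ex; exists y; rewrite hold_and, hold_all_imp; split.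
      * apply (hold_tmem _ _ _ (opairN x y) (lk e f));
          [apply den_opair; dvar|dvar|apply Hy].
      * revert Hn; apply near_mono; intros r [_ Hr] y' Hy'.
        rewrite hold_eq; lks; apply Hr.
        apply (hold_tmem _ _ _ (opairN x y') (lk e f)) in Hy'; auto;
          [apply den_opair|]; dvar.
Qed.

Lemma FunS_val A B P Q F u t : cls A P -> cls B Q -> FunS P Q F t -> P u t ->
  exists v, Q v t /\ val F u v t.
Proof.
  intros HA HB H Hu; apply near_here in H; destruct H as [H1 H2].
  destruct (H2 u Hu) as [v Hv]; exists v; split; auto.
  destruct (H1 _ (proj1 Hv)) as (x & y & _ & Hy & E).
  apply eqn_opair in E; destruct E as [_ E].
  apply (cls_congr _ _ _ _ _ HB (eqn_sym _ _ _ _ E) Hy).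
Qed.

Lemma den_ap a b e F u v t :
  den a e F t -> den b e u t -> val F u v t -> den (ap a b) e v t.
Proof.
  intros Ha Hb [Hm Hu] l z Hz; unfold ap.
  rewrite (hold_bind _ _ _ F) by (apply den_app, Ha).
  rewrite (hold_bind _ _ _ u) by (apply den_cons, den_app, Hb).
  rewrite (hold_tmem _ _ _ (opairN u (lk (l ++ e) z)) F);
    [|apply den_opair; dvar|dvar].
  split; [auto|]; intros E; apply mem_eqn_l with (opairN u v); auto.
  apply eqn_opair; split; [apply eqn_refl|apply eqn_sym; auto].
Qed.

(** The function that maps [a i] to [b j] where [R i j] holds; it may take
    different values on different parts of the space. *)
Definition graphN {I J : Type} (a : I -> name X) (b : J -> name X)
  (R : I -> J -> pt X -> Prop) : name X :=
  Name (I * J) (fun p => opairN (a (fst p)) (b (snd p)))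
    (fun p => R (fst p) (snd p)).

Section Graph.
Variables (I J : Type) (a : I -> name X) (b : J -> name X) (R : I -> J -> pt X -> Prop).
Hypothesis uniq : forall i i' j j' s, eqn (a i) (a i') s ->
  near s (R i j) -> near s (R i' j') -> eqn (b j) (b j') s.

Lemma val_graph i j t : near t (R i j) -> val (graphN a b R) (a i) (b j) t.
Proof.
  intros H; split.
  - apply mem_char; exists (i, j); split; [exact H|apply eqn_refl].
  - intros v' Hv; apply mem_char in Hv; destruct Hv as ([i' j'] & Hw & E); cbn in *.
    apply eqn_opair in E; destruct E as [E1 E2].
    apply eqn_trans with (b j'); auto; apply eqn_sym; eauto.
Qed.

Lemma FunS_graph (Q : name X -> pt X -> Prop) t :
  (forall i s, exists j, near s (R i j)) ->
  (forall j s, Q (b j) s) ->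
  FunS (range a) Q (graphN a b R) t.
Proof.
  intros Htot HQ; apply near_top; intros s; split.
  - intros p Hp; apply mem_char in Hp; destruct Hp as ([i j] & Hw & E); cbn in *.
    exists (a i), (b j); split; [exists i; apply eqn_refl|split; auto].
  - intros x [i Hi]; destruct (Htot i s) as [j Hj]; exists (b j).
    destruct (val_graph i j s Hj) as [Hm Hu]; split.
    + apply mem_eqn_l with (opairN (a i) (b j)); auto; apply eqn_opair.
      split; [apply eqn_sym; auto|apply eqn_refl].
    + intros v' Hv; apply Hu; apply mem_eqn_l with (opairN x v'); auto.
      apply eqn_opair; split; [auto|apply eqn_refl].
Qed.

End Graph.

End Terms.

Arguments opairN {X}. Arguments cls {X}. Arguments range {X I}. Arguments val {X}.
Arguments FunS {X}. Arguments graphN {X I J}.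

(** * Natural numbers *)

Section Numbers.
Variable X : space.
Implicit Types (t s r : pt X) (u v w : name X) (e l : list (name X)).

Lemma mem_num_num j k t : mem (X:=X) (numN j) (numN k) t <-> j < k.
Proof.
  rewrite mem_num; split.
  - intros (i & Hi & E); destruct (Nat.lt_trichotomy i j) as [H|[->|H]]; auto.
    + destruct (mem_irrefl X (numN i) t).
      apply (mem_eqn_r _ _ _ _ _ E), mem_num; exists i; split; auto; apply eqn_refl.
    + destruct (mem_irrefl X (numN j) t).
      apply (mem_eqn_r _ _ _ _ _ (eqn_sym _ _ _ _ E)), mem_num.
      exists j; split; auto; apply eqn_refl.
  - intros H; exists j; split; auto; apply eqn_refl.
Qed.

Lemma eqn_num j k t : eqn (X:=X) (numN j) (numN k) t <-> j = k.
Proof.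
  split; [|intros ->; apply eqn_refl].
  intros E; destruct (Nat.lt_trichotomy j k) as [H|[->|H]]; auto; exfalso.
  - apply (mem_num_num j k t), (mem_eqn_l _ _ _ _ _ E), mem_num_num in H; lia.
  - apply (mem_num_num k j t), (mem_eqn_l _ _ _ _ _ (eqn_sym _ _ _ _ E)),
      mem_num_num in H; lia.
Qed.

Lemma hold_inductive e x t : x < length e ->
  (hold e (inductive x) t <-> mem emptyN (lk e x) t /\
   near t (fun s => forall v, mem v (lk e x) s -> mem (succN v) (lk e x) s)).
Proof.
  intros Hx; unfold inductive; rewrite hold_and, hold_all_imp.
  rewrite (hold_tmem _ _ _ _ emptyN (lk e x)); [|apply den_empty|dvar].
  assert (K : forall v s, hold (v :: e) (tmem (succ (var (length e))) (var x)) s <->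
    mem (succN v) (lk e x) s).
  { intros v s; apply hold_tmem; [apply den_succ|]; dvar. }
  split; (intros [H1 H2]; split; [exact H1|]); revert H2; apply near_mono;
    intros s H v; specialize (H v); rewrite K, hold_mem in *; lks; lks_in H; exact H.
Qed.

Lemma cls_Nat : cls (X:=X) Nat (range numN).
Proof.
  intros e x t Hx; unfold Nat; rewrite hold_all_imp; split.
  - intros H; apply near_here in H; specialize (H omegaN).
    rewrite hold_inductive, hold_mem in H by len; lks_in H.
    apply mem_full, H; split; [apply mem_full; exists 0; apply eqn_refl|].
    apply near_top; intros s v Hv; apply mem_full in Hv; destruct Hv as [k E].
    apply mem_full; exists (S k); apply eqn_succ, E.
  - intros [k E]; apply eqn_near in E; revert E; apply near_mono; intros s E v Hv.
    rewrite hold_inductive in Hv by len; rewrite hold_mem; lks; lks_in Hv.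
    destruct Hv as [H0 HS]; apply near_here in HS.
    apply (mem_eqn_l _ _ _ _ _ (eqn_sym _ _ _ _ E)).
    clear E; induction k as [|k IH]; [exact H0|exact (HS _ IH)].
Qed.

Lemma cls_Natpos : cls (X:=X) Natpos (range (fun k => numN (S k))).
Proof.
  intros e x t Hx; unfold Natpos; rewrite hold_and, (cls_iff _ _ _ _ _ _ cls_Nat Hx).
  rewrite (hold_tmem _ _ _ _ emptyN (lk e x)); [|apply den_empty|dvar].
  split.
  - intros [[[|k] E] H]; [|exists k; exact E].
    destruct (mem_empty _ _ _ (mem_eqn_r _ _ _ _ _ E H)).
  - intros [k E]; split; [exists (S k); exact E|].
    apply (mem_eqn_r _ _ _ _ _ (eqn_sym _ _ _ _ E)).
    apply (mem_num_num 0 (S k)); lia.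
Qed.

Lemma val_unique F u v v' t : val (X:=X) F u v t -> val F u v' t -> eqn v v' t.
Proof. intros [H _] [_ H']; auto. Qed.

(** Sums and products are defined in set theory by recursion along a function
    that is a set.  Natural numbers of the model being numerals, such a function
    is at each point given by a function on [nat], and the recursion equations
    determine the latter; conversely the graph of [Nat.iter] is such a set. *)
Lemma hold_rec (base : tm) (step : tm -> tm) (arg : tm) e (b m : nat)
  (g : nat -> nat) (z : lvl) t :
  (forall l s, den base (l ++ e) (numN b) s) ->
  (forall l a j s, den a (l ++ e) (numN j) s ->
                   den (step a) (l ++ e) (numN (g j)) s) ->
  (forall l s, den arg (l ++ e) (numN m) s) ->
  z < length e ->
  (hold e (∃ f, Fun Nat Nat f ∧ teq (ap f empty) base ∧
     (∀ n, Nat n ⇒ teq (ap f (succ n)) (step (ap f n))) ∧ ap f arg z)%fm t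
   <-> eqn (lk e z) (numN (Nat.iter m g b)) t).
Proof.
  intros Hb Hs Ha Hz.
  split.
  - rewrite hold_ex; intros [F HF]; rewrite !hold_and in HF.
    destruct HF as (HF & H0 & HS & Hap).
    apply (cls_Fun _ _ _ _ _ cls_Nat cls_Nat) in HF; [|len]; lks_in HF.
    rewrite (hold_all_range _ _ _ _ _ _ cls_Nat) in HS; apply near_here in HS.
    assert (Hval : forall n, exists k, val F (numN n) (numN k) t).
    { intros n; destruct (FunS_val _ _ _ _ _ _ (numN n) t cls_Nat cls_Nat HF)
        as (v & [k E] & Hm & Hu); [exists n; apply eqn_refl|].
      exists k; split.
      - apply mem_eqn_l with (opairN (numN n) v); auto; apply eqn_opair.
        split; [apply eqn_refl|exact E].
      - intros v' Hv'; apply eqn_trans with v; auto. }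
    assert (Hden : forall a n k l, val F (numN n) (numN k) t ->
      den a (l ++ F :: e) (numN n) t ->
      den (ap (var (length e)) a) (l ++ F :: e) (numN k) t).
    { intros a n k l Hk Hn; apply (den_ap _ _ _ _ F (numN n)); auto; dvar. }
    assert (Hiter : forall n, val F (numN n) (numN (Nat.iter n g b)) t).
    { induction n as [|n IH].
      - destruct (Hval 0) as [k Hk].
        rewrite (hold_teq _ _ _ _ (numN k) (numN b)), eqn_num in H0.
        + rewrite H0 in Hk; exact Hk.
        + apply (Hden empty 0 k [] Hk), den_empty.
        + apply (Hb [F]).
      - destruct (Hval (S n)) as [k Hk]; specialize (HS n).
        rewrite (hold_teq _ _ _ _ (numN k) (numN (g (Nat.iter n g b)))), eqn_num
          in HS.
        + rewrite HS in Hk; exact Hk.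
        + apply (Hden _ (S n) k [numN n] Hk), den_succ; dvar.
        + apply (Hs [numN n; F]), (Hden _ n _ [numN n] IH); dvar. }
    apply (den_unfold _ _ _ (numN (Nat.iter m g b))) in Hap; [lks_in Hap; exact Hap| |len].
    apply (Hden arg m _ [] (Hiter m)), (Ha [F]).
  - intros E.
    set (R := fun i j (_ : pt X) => j = Nat.iter i g b).
    set (F := graphN numN numN R).
    assert (Huniq : forall i i' j j' s, eqn (X:=X) (numN i) (numN i') s ->
      near s (R i j) -> near s (R i' j') -> eqn (X:=X) (numN j) (numN j') s).
    { intros i i' j j' s Ei H H'; apply near_here in H, H'; apply eqn_num in Ei.
      unfold R in *; subst; apply eqn_refl. }
    assert (Hval : forall n s, val F (numN n) (numN (Nat.iter n g b)) s).
    { intros n s; apply val_graph; [exact Huniq|apply near_top; reflexivity]. }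
    assert (Hden : forall a n l s, den a (l ++ F :: e) (numN n) s ->
      den (ap (var (length e)) a) (l ++ F :: e) (numN (Nat.iter n g b)) s).
    { intros a n l s Hn; apply (den_ap _ _ _ _ F (numN n)); auto; dvar. }
    rewrite hold_ex; exists F; rewrite !hold_and; split; [|split; [|split]].
    + apply (cls_Fun _ _ _ _ _ cls_Nat cls_Nat); [len|]; lks.
      apply FunS_graph; [exact Huniq| |].
      * intros i s; exists (Nat.iter i g b); apply near_top; reflexivity.
      * intros j s; exists j; apply eqn_refl.
    + apply (hold_teq _ _ _ _ (numN b) (numN b)); [|apply (Hb [F])|apply eqn_refl].
      apply (Hden empty 0 []), den_empty.
    + rewrite (hold_all_range _ _ _ _ _ _ cls_Nat); apply near_top; intros s n.
      apply (hold_teq _ _ _ _ (numN (Nat.iter (S n) g b)) (numN (Nat.iter (S n) g b)));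
        [| |apply eqn_refl].
      * apply (Hden _ (S n) [numN n]), den_succ; dvar.
      * apply (Hs [numN n; F]), (Hden _ n [numN n]); dvar.
    + apply (den_unfold _ _ _ (numN (Nat.iter m g b))); [|len|lks; exact E].
      apply (Hden arg m []), (Ha [F]).
Qed.

Lemma den_nadd a b e i j t : den a e (numN i) t -> den b e (numN j) t ->
  den (X:=X) (nadd a b) e (numN (i + j)) t.
Proof.
  intros Ha Hb l z Hz; unfold nadd.
  rewrite (hold_bind _ _ _ (numN i)) by (apply den_app, Ha).
  rewrite (hold_bind _ _ _ (numN j)) by (apply den_cons, den_app, Hb).
  rewrite (hold_rec _ _ _ _ i j S).
  - lks; replace (Nat.iter j S i) with (i + j); [reflexivity|].
    clear; induction j as [|j IH]; [cbn; lia|].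
    rewrite Nat.iter_succ, <- IH; lia.
  - intros; dvar.
  - intros l' a' k s; apply den_succ.
  - intros; dvar.
  - len.
Qed.

Lemma den_nmul a b e i j t : den a e (numN i) t -> den b e (numN j) t ->
  den (X:=X) (nmul a b) e (numN (i * j)) t.
Proof.
  intros Ha Hb l z Hz; unfold nmul.
  rewrite (hold_bind _ _ _ (numN i)) by (apply den_app, Ha).
  rewrite (hold_bind _ _ _ (numN j)) by (apply den_cons, den_app, Hb).
  rewrite (hold_rec _ (fun a => nadd a (var (length (l ++ e)))) _ _ 0 j (fun k => k + i)).
  - lks; replace (Nat.iter j (fun k => k + i) 0) with (i * j); [reflexivity|].
    clear; induction j as [|j IH]; [cbn; lia|].
    rewrite Nat.iter_succ, <- IH; lia.
  - intros; apply den_empty.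
  - intros l' a' k s Hk; apply den_nadd; [exact Hk|dvar].
  - intros; dvar.
  - len.
Qed.

(** * Rational numbers *)

(** Denominators are successors, as the third component of a fraction is
    positive. *)
Definition fracQ (a b d : nat) : Q := (Z.of_nat a - Z.of_nat b) # Pos.of_succ_nat d.

Lemma fracQ_eq a b d a' b' d' : fracQ a b d == fracQ a' b' d' <->
  a * S d' + b' * S d = a' * S d + b * S d'.
Proof.
  unfold fracQ, Qeq; cbn [Qnum Qden]; 
  change (Z.pos (Pos.of_succ_nat d)) with (Z.of_nat (S d)).
  change (Z.pos (Pos.of_succ_nat d')) with (Z.of_nat (S d')).
  split; lia.
Qed.

Lemma fracQ_lt a b d a' b' d' : (fracQ a b d < fracQ a' b' d')%Q <->
  a * S d' + b' * S d < a' * S d + b * S d'.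
Proof.
  unfold fracQ, Qlt; cbn [Qnum Qden]; 
  change (Z.pos (Pos.of_succ_nat d)) with (Z.of_nat (S d)).
  change (Z.pos (Pos.of_succ_nat d')) with (Z.of_nat (S d')).
  split; lia.
Qed.

Lemma fracQ_surj q : exists a b d, fracQ a b d == q.
Proof.
  destruct q as [n d]; exists (Z.to_nat n), (Z.to_nat (- n)), (pred (Pos.to_nat d)).
  unfold fracQ; replace (Pos.of_succ_nat (pred (Pos.to_nat d))) with d.
  - replace (Z.of_nat (Z.to_nat n) - Z.of_nat (Z.to_nat (- n)))%Z with n by lia.
    reflexivity.
  - pose proof (Pos2Nat.is_pos d); apply Pos2Nat.inj.
    rewrite SuccNat2Pos.id_succ; lia.
Qed.

Definition ratN (q : Q) : name X :=
  full {p : nat * nat * nat | fracQ (fst (fst p)) (snd (fst p)) (snd p) == q}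
    (fun p => let '(a, b, d) := proj1_sig p in
              opairN (opairN (numN a) (numN b)) (numN (S d))).

Lemma mem_rat w q t : mem w (ratN q) t <-> exists a b d, fracQ a b d == q /\
  eqn w (opairN (opairN (numN a) (numN b)) (numN (S d))) t.
Proof.
  unfold ratN; rewrite mem_full; split.
  - intros [[[[a b] d] Hq] E]; exists a, b, d; auto.
  - intros (a & b & d & Hq & E); exists (exist _ (a, b, d) Hq); exact E.
Qed.

Lemma eqn_rat p q t : eqn (ratN p) (ratN q) t <-> p == q.
Proof.
  split; intros H.
  - apply eqn_ext, near_here in H; destruct (fracQ_surj p) as (a & b & d & Hp).
    assert (Hm : mem (opairN (opairN (numN a) (numN b)) (numN (S d))) (ratN p) t).
    { apply mem_rat; exists a, b, d; split; auto; apply eqn_refl. }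
    apply H, mem_rat in Hm; destruct Hm as (a' & b' & d' & Hq & E).
    rewrite !eqn_opair, !eqn_num in E; destruct E as [[-> ->] E].
    injection E as ->; rewrite <- Hp; exact Hq.
  - apply eqn_ext, near_top; intros s w; rewrite !mem_rat.
    split; intros (a & b & d & Hq & E); exists a, b, d; split; auto;
      rewrite Hq; [|symmetry]; exact H.
Qed.

Lemma den_rat a p q e t : p == q -> den a e (ratN p) t -> den a e (ratN q) t.
Proof. intros H; apply den_eqn, eqn_rat, H. Qed.

Lemma hold_ex_nat3 e G t :
  hold (X:=X) e (∃ i j k, Nat i ∧ Nat j ∧ Natpos k ∧ G i j k)%fm t <->
  exists i j k, hold (numN (S k) :: numN j :: numN i :: e)
    (G (length e) (S (length e)) (S (S (length e)))) t.
Proof.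
  split.
  - rewrite hold_ex; intros [u H]; rewrite hold_ex in H; destruct H as [v H].
    rewrite hold_ex in H; destruct H as [w H]; rewrite !hold_and in H.
    destruct H as (Hu & Hv & Hw & H).
    apply cls_Nat in Hu; [|len]; apply cls_Nat in Hv; [|len].
    apply cls_Natpos in Hw; [|len]; lks_in Hu; lks_in Hv; lks_in Hw.
    destruct Hu as [i Hi], Hv as [j Hj], Hw as [k Hk]; exists i, j, k.
    revert H; apply hold_congr; repeat constructor; auto; apply Forall2_eqn_refl.
  - intros (i & j & k & H); rewrite hold_ex; exists (numN i).
    rewrite hold_ex; exists (numN j); rewrite hold_ex; exists (numN (S k)).
    rewrite !hold_and.
    split; [apply cls_Nat; [len|]; lks; exists i; apply eqn_refl|].
    split; [apply cls_Nat; [len|]; lks; exists j; apply eqn_refl|].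
    split; [apply cls_Natpos; [len|]; lks; exists k; apply eqn_refl|exact H].
Qed.

Lemma den_frac a b d e i j k t :
  den a e (numN i) t -> den b e (numN j) t -> den d e (numN (S k)) t ->
  den (X:=X) (frac a b d) e (ratN (fracQ i j k)) t.
Proof.
  intros Ha Hb Hd l z Hz; unfold frac.
  rewrite (hold_bind _ _ _ (numN i)) by (apply den_app, Ha).
  rewrite (hold_bind _ _ _ (numN j)) by (apply den_cons, den_app, Hb).
  rewrite (hold_bind _ _ _ (numN (S k))) by (do 2 apply den_cons; apply den_app, Hd).
  rewrite !hold_and, (hold_ext _ _ _ (ratN (fracQ i j k))); [|len|].
  - rewrite !(cls_iff _ _ _ _ _ _ cls_Nat), (cls_iff _ _ _ _ _ _ cls_Natpos) by len; lks.
    split; [tauto|]; intros E; repeat split; [exists i|exists j|exists k|exact E];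
      apply eqn_refl.
  - intros s w; rewrite mem_rat, hold_ex_nat3; cbn [length].
    assert (K : forall i' j' k', hold
      (numN (S k') :: numN j' :: numN i' :: w :: numN (S k) :: numN j :: numN i :: l ++ e)
      (fand (opair (opair (var (4 + length (l ++ e))) (var (5 + length (l ++ e))))
               (var (6 + length (l ++ e))) (3 + length (l ++ e)))
        (teq (nadd (nmul (var (4 + length (l ++ e))) (var (2 + length (l ++ e))))
                   (nmul (var (1 + length (l ++ e))) (var (6 + length (l ++ e)))))
             (nadd (nmul (var (length (l ++ e))) (var (6 + length (l ++ e))))
                   (nmul (var (5 + length (l ++ e))) (var (2 + length (l ++ e))))))) s
      <-> eqn w (opairN (opairN (numN i') (numN j')) (numN (S k'))) s /\
          fracQ i' j' k' == fracQ i j k).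
    { intros i' j' k'; rewrite hold_and, fracQ_eq.
      rewrite (den_unfold _ _ _ (opairN (opairN (numN i') (numN j')) (numN (S k'))));
        [|repeat apply den_opair; dvar|len].
      rewrite (hold_teq _ _ _ _ (numN (i' * S k + j * S k'))
        (numN (i * S k' + j' * S k))); [|apply den_nadd; apply den_nmul; dvar..].
      rewrite eqn_num; lks; reflexivity. }
    split.
    + intros (i' & j' & k' & Hq & E); exists i', j', k'; apply K; auto.
    + intros (i' & j' & k' & H); exists i', j', k'; apply K in H; tauto.
Qed.

Lemma hold_frac e a b d q t : a < length e -> b < length e -> d < length e ->
  q < length e ->
  (hold (X:=X) e (frac (var a) (var b) (var d) q) t <-> exists i j k,
     eqn (lk e a) (numN i) t /\ eqn (lk e b) (numN j) t /\
     eqn (lk e d) (numN (S k)) t /\ eqn (lk e q) (ratN (fracQ i j k)) t).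
Proof.
  intros Ha Hb Hd Hq.
  assert (K : forall i j k, eqn (lk e a) (numN i) t -> eqn (lk e b) (numN j) t ->
    eqn (lk e d) (numN (S k)) t ->
    (hold e (frac (var a) (var b) (var d) q) t <->
     eqn (lk e q) (ratN (fracQ i j k)) t)).
  { intros i j k Hi Hj Hk.
    apply (den_unfold _ _ _ (ratN (fracQ i j k))); [|exact Hq].
    apply den_frac; [apply den_eqn with (lk e a)|apply den_eqn with (lk e b)
      |apply den_eqn with (lk e d)]; auto; apply den_var; auto. }
  split.
  - intros H; assert (exists i j k, eqn (lk e a) (numN i) t /\
      eqn (lk e b) (numN j) t /\ eqn (lk e d) (numN (S k)) t) as (i & j & k & H3).
    { clear K; unfold frac in H.
      rewrite (hold_bind _ _ _ (lk e a)) in H by dvar.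
      rewrite (hold_bind _ _ _ (lk e b)) in H by dvar.
      rewrite (hold_bind _ _ _ (lk e d)) in H by dvar.
      rewrite !hold_and, !(cls_iff _ _ _ _ _ _ cls_Nat),
        (cls_iff _ _ _ _ _ _ cls_Natpos) in H by len; lks_in H.
      destruct H as ([i Hi] & [j Hj] & [k Hk] & _); exists i, j, k; auto. }
    exists i, j, k; destruct H3 as (H1 & H2 & H3).
    repeat split; auto; apply (K i j k); auto.
  - intros (i & j & k & H1 & H2 & H3 & H4); apply (K i j k); auto.
Qed.

Lemma cls_Rat : cls (X:=X) Rat (range ratN).
Proof.
  intros e x t Hx; unfold Rat; split.
  - rewrite hold_ex; intros [u H]; rewrite hold_ex in H; destruct H as [v H].
    rewrite hold_ex in H; destruct H as [w H].
    rewrite hold_frac in H by len; lks_in H.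
    destruct H as (i & j & k & _ & _ & _ & E); exists (fracQ i j k); exact E.
  - intros [q E]; destruct (fracQ_surj q) as (i & j & k & Hq).
    rewrite hold_ex; exists (numN i); rewrite hold_ex; exists (numN j).
    rewrite hold_ex; exists (numN (S k)); rewrite hold_frac by len; lks.
    exists i, j, k; repeat split; try apply eqn_refl.
    apply eqn_trans with (ratN q); auto; apply eqn_rat; symmetry; auto.
Qed.

(** The operations on rationals are defined through arbitrary representing
    fractions; the representatives can be taken to be numerals. *)
Lemma hold_ex_fracs e p q P Q G t : p < length e -> q < length e ->
  lk e p = ratN P -> lk e q = ratN Q ->
  (hold (X:=X) e (∃ a b d a' b' d',
     frac a b d p ∧ frac a' b' d' q ∧ G a b d a' b' d')%fm t <->
   exists i j k i' j' k', fracQ i j k == P /\ fracQ i' j' k' == Q /\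
     hold (numN (S k') :: numN j' :: numN i' :: numN (S k) :: numN j :: numN i :: e)
       (let n := length e in G n (S n) (S (S n)) (S (S (S n))) (S (S (S (S n))))
                               (S (S (S (S (S n)))))) t).
Proof.
  intros Hp Hq EP EQ; split.
  - rewrite hold_ex; intros [a H]; rewrite hold_ex in H; destruct H as [b H].
    rewrite hold_ex in H; destruct H as [d H]; rewrite hold_ex in H.
    destruct H as [a' H]; rewrite hold_ex in H; destruct H as [b' H].
    rewrite hold_ex in H; destruct H as [d' H]; rewrite !hold_and in H.
    rewrite !hold_frac in H by len; lks_in H.
    destruct H as ((i & j & k & Ei & Ej & Ek & E1) &
      (i' & j' & k' & Ei' & Ej' & Ek' & E2) & H).
    rewrite EP, eqn_rat in E1; rewrite EQ, eqn_rat in E2.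
    exists i, j, k, i', j', k'; split; [symmetry; auto|]; split; [symmetry; auto|].
    revert H; apply hold_congr; repeat constructor; auto; apply Forall2_eqn_refl.
  - intros (i & j & k & i' & j' & k' & E1 & E2 & H).
    rewrite hold_ex; exists (numN i); rewrite hold_ex; exists (numN j).
    rewrite hold_ex; exists (numN (S k)); rewrite hold_ex; exists (numN i').
    rewrite hold_ex; exists (numN j'); rewrite hold_ex; exists (numN (S k')).
    rewrite !hold_and, !hold_frac by len; lks; rewrite EP, EQ.
    split; [|split; [|exact H]].
    + exists i, j, k; repeat split; try apply eqn_refl; apply eqn_rat; symmetry; auto.
    + exists i', j', k'; repeat split; try apply eqn_refl; apply eqn_rat; symmetry; auto.
Qed.

Lemma hold_qlt a b e P Q t : den a e (ratN P) t -> den b e (ratN Q) t ->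
  (hold (X:=X) e (qlt a b) t <-> (P < Q)%Q).
Proof.
  intros Ha Hb; unfold qlt.
  rewrite (hold_bind _ _ _ (ratN P)) by apply Ha.
  rewrite (hold_bind _ _ _ (ratN Q)) by apply den_cons, Hb.
  rewrite (hold_ex_fracs _ _ _ P Q) by (try len; lks; reflexivity).
  assert (K : forall i j k i' j' k', hold (X:=X)
    (numN (S k') :: numN j' :: numN i' :: numN (S k) :: numN j :: numN i ::
     ratN Q :: ratN P :: e)
    (let n := S (S (length e)) in
     tmem (nadd (nmul (var n) (var (5 + n))) (nmul (var (4 + n)) (var (2 + n))))
          (nadd (nmul (var (3 + n)) (var (2 + n))) (nmul (var (1 + n)) (var (5 + n))))) t
    <-> (fracQ i j k < fracQ i' j' k')%Q).
  { intros i j k i' j' k'; rewrite fracQ_lt, <- mem_num_num with (t := t).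
    apply hold_tmem; apply den_nadd; apply den_nmul; dvar. }
  split.
  - intros (i & j & k & i' & j' & k' & E1 & E2 & H); apply K in H.
    rewrite <- E1, <- E2; exact H.
  - intros H; destruct (fracQ_surj P) as (i & j & k & E1).
    destruct (fracQ_surj Q) as (i' & j' & k' & E2).
    exists i, j, k, i', j', k'; split; [auto|split; [auto|]]; apply K.
    rewrite E1, E2; exact H.
Qed.

Lemma den_qadd a b e P Q t : den a e (ratN P) t -> den b e (ratN Q) t ->
  den (X:=X) (qadd a b) e (ratN (P + Q)) t.
Proof.
  intros Ha Hb l z Hz; unfold qadd.
  rewrite (hold_bind _ _ _ (ratN P)) by apply den_app, Ha.
  rewrite (hold_bind _ _ _ (ratN Q)) by apply den_cons, den_app, Hb.
  rewrite (hold_ex_fracs _ _ _ P Q) by (try len; lks; reflexivity).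
  assert (K : forall i j k i' j' k', fracQ i j k == P -> fracQ i' j' k' == Q ->
    (hold (X:=X)
    (numN (S k') :: numN j' :: numN i' :: numN (S k) :: numN j :: numN i ::
     ratN Q :: ratN P :: l ++ e)
    (let n := S (S (length (l ++ e))) in
     frac (nadd (nmul (var n) (var (5 + n))) (nmul (var (3 + n)) (var (2 + n))))
          (nadd (nmul (var (1 + n)) (var (5 + n))) (nmul (var (4 + n)) (var (2 + n))))
          (nmul (var (2 + n)) (var (5 + n))) z) t
    <-> eqn (lk (l ++ e) z) (ratN (P + Q)) t)).
  { intros i j k i' j' k' E1 E2.
    rewrite (den_unfold _ _ _ (ratN (P + Q))); [lks; reflexivity| |len].
    apply den_rat with (fracQ (i * S k' + i' * S k) (j * S k' + j' * S k)
                          (k' + k * S k')).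
    - rewrite <- E1, <- E2; unfold fracQ, Qeq; cbn [Qnum Qden Qplus].
      rewrite Pos2Z.inj_mul.
      change (Z.pos (Pos.of_succ_nat k)) with (Z.of_nat (S k)).
      change (Z.pos (Pos.of_succ_nat k')) with (Z.of_nat (S k')).
      change (Z.pos (Pos.of_succ_nat (k' + k * S k'))) with (Z.of_nat (S k * S k')).
      rewrite !Nat2Z.inj_add, !Nat2Z.inj_mul; ring.
    - apply den_frac; [apply den_nadd; apply den_nmul; dvar..|].
      apply (den_nmul _ _ _ (S k) (S k')); dvar. }
  split.
  - intros (i & j & k & i' & j' & k' & E1 & E2 & H); apply (K i j k i' j' k'); auto.
  - intros H; destruct (fracQ_surj P) as (i & j & k & E1).
    destruct (fracQ_surj Q) as (i' & j' & k' & E2).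
    exists i, j, k, i', j', k'; split; [auto|split; [auto|]]; apply K; auto.
Qed.

Lemma den_qopp a e P t : den a e (ratN P) t -> den (X:=X) (qopp a) e (ratN (- P)) t.
Proof.
  intros Ha l z Hz; unfold qopp.
  rewrite (hold_bind _ _ _ (ratN P)) by apply den_app, Ha.
  assert (K : forall i j k, - fracQ i j k == fracQ j i k).
  { intros i j k; unfold fracQ, Qeq; cbn [Qnum Qden Qopp]; ring. }
  split.
  - rewrite hold_ex; intros [u H]; rewrite hold_ex in H; destruct H as [v H].
    rewrite hold_ex in H; destruct H as [w H].
    rewrite hold_and, !hold_frac in H by len; lks_in H.
    destruct H as ((i & j & k & Ei & Ej & Ek & E) & (j' & i' & k' & Ej' & Ei' & Ek' & E')).
    apply eqn_rat in E; apply eqn_trans with (1 := E'), eqn_rat; rewrite E, K.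
    assert (i = i') as <- by (apply (eqn_num _ _ t), eqn_trans with u; auto;
      apply eqn_sym; auto).
    assert (j = j') as <- by (apply (eqn_num _ _ t), eqn_trans with v; auto;
      apply eqn_sym; auto).
    assert (S k = S k') as Hk by (apply (eqn_num _ _ t), eqn_trans with w; auto;
      apply eqn_sym; auto).
    injection Hk as <-; reflexivity.
  - intros E; destruct (fracQ_surj P) as (i & j & k & HP).
    rewrite hold_ex; exists (numN i); rewrite hold_ex; exists (numN j).
    rewrite hold_ex; exists (numN (S k)); rewrite hold_and, !hold_frac by len; lks.
    split; [exists i, j, k|exists j, i, k]; repeat split; try apply eqn_refl.
    + apply eqn_rat; symmetry; exact HP.
    + apply eqn_trans with (1 := E), eqn_rat; rewrite <- K, HP; reflexivity.
Qed.

Lemma den_qsub a b e P Q t : den a e (ratN P) t -> den b e (ratN Q) t ->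
  den (X:=X) (qsub a b) e (ratN (P - Q)) t.
Proof. intros Ha Hb; apply den_qadd, den_qopp; assumption. Qed.

Lemma den_qinv_nat a e k t : den a e (numN (S k)) t ->
  den (X:=X) (qinv_nat a) e (ratN (1 # Pos.of_succ_nat k)) t.
Proof.
  intros Ha; apply (den_frac _ _ _ _ 1 0 k); [apply den_succ, den_empty| |exact Ha].
  apply den_empty.
Qed.

Lemma den_qzero e t : den (X:=X) qzero e (ratN 0) t.
Proof.
  apply den_rat with (fracQ 0 0 0); [reflexivity|].
  apply den_frac; try apply den_empty; apply den_succ, den_empty.
Qed.

Lemma den_qabs a e P t : den a e (ratN P) t ->
  den (X:=X) (qabs a) e (ratN (Qabs P)) t.
Proof.
  intros Ha l z Hz; unfold qabs.
  rewrite (hold_bind _ _ _ (ratN P)) by apply den_app, Ha.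
  assert (K : forall s, hold (ratN P :: l ++ e) (qlt (var (length (l ++ e))) qzero) s
    <-> (P < 0)%Q) by (intros s; apply hold_qlt; [dvar|apply den_qzero]).
  rewrite hold_or, !hold_and, hold_eq, hold_not, K; lks.
  rewrite (den_unfold _ _ _ (ratN (- P))) by (try len; apply den_qopp; dvar); lks.
  assert (HN : near t (fun s => ~ hold (ratN P :: l ++ e)
    (qlt (var (length (l ++ e))) qzero) s) <-> ~ (P < 0)%Q).
  { split; [intros H; apply near_here in H; rewrite K in H; exact H|].
    intros H; apply near_top; intros s; rewrite K; exact H. }
  rewrite HN; clear K HN; destruct (Qlt_le_dec P 0) as [H|H].
  - assert (E : eqn (ratN (Qabs P)) (ratN (- P)) t)
      by (apply eqn_rat, Qabs_neg; lra).
    rewrite (eqn_iff_r _ _ _ _ _ E); intuition.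
  - assert (E : eqn (ratN (Qabs P)) (ratN P) t) by (apply eqn_rat, Qabs_pos; lra).
    rewrite (eqn_iff_r _ _ _ _ _ E); assert (~ (P < 0)%Q) by lra; intuition.
Qed.

Definition posN (p : {q : Q | (0 < q)%Q}) : name X := ratN (proj1_sig p).

Lemma cls_Ratpos : cls (X:=X) Ratpos (range posN).
Proof.
  intros e x t Hx; unfold Ratpos; rewrite hold_and, (cls_iff _ _ _ _ _ _ cls_Rat Hx).
  assert (K : forall q, eqn (lk e x) (ratN q) t ->
    (hold e (qlt qzero (var x)) t <-> (0 < q)%Q)).
  { intros q E; apply hold_qlt; [apply den_qzero|].
    apply den_eqn with (1 := E), den_var, Hx. }
  split.
  - intros [[q E] H]; apply (K q E) in H; exists (exist _ q H); exact E.
  - intros [[q Hq] E]; split; [exists q; exact E|]; apply (K q E), Hq.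
Qed.

End Numbers.

Arguments ratN {X}. Arguments posN {X}.

(** * Sequences of rationals *)

Section Sequences.
Variable X : space.
Implicit Types (t s r : pt X) (u v w F : name X) (e l : list (name X)).

Notation isNat := (range (X:=X) numN).
Notation isRat := (range (X:=X) ratN).

(** The formulas about sequences have their expected meaning only where the sets
    in them are functions, which is an open condition [C]. *)
Lemma near_iff_on t (C P R : pt X -> Prop) : near t C ->
  (forall s, near s C -> (P s <-> R s)) -> (near t P <-> near t R).
Proof.
  intros HC H; apply near_near in HC; split; intros K;
    apply (near_imp _ _ _ _ (near_and _ _ _ HC K)); intros s [H1 H2];
    apply (H s H1), H2.
Qed.

Lemma near_all_near {I : Type} t (P : I -> pt X -> Prop) :
  near t (fun s => forall i, near s (P i)) <-> near t (fun s => forall i, P i s).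
Proof.
  split; [apply near_mono; intros s H i; exact (near_here _ _ (H i))|].
  apply near_open; intros s H i; revert H; apply near_mono; auto.
Qed.

Lemma hold_all_nat1 e A G t :
  hold e (∀ k, Nat k ∧ A k ⇒ G k)%fm t <->
  near t (fun s => forall k, hold (numN k :: e) (A (length e)) s ->
                             hold (numN k :: e) (G (length e)) s).
Proof.
  rewrite hold_all_imp; split; apply near_mono; intros s H.
  - intros k HA; apply H; rewrite hold_and; split; auto.
    apply cls_Nat; [len|]; lks; exists k; apply eqn_refl.
  - intros v Hv; rewrite hold_and, (cls_iff _ _ _ _ _ _ (cls_Nat X)) in Hv by len.
    lks_in Hv; destruct Hv as [[k E] HA]; apply (hold_congr1 _ _ (numN k)).
    + apply eqn_sym; auto.
    + apply H; revert HA; apply hold_congr1, E.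
Qed.

Lemma hold_all_nat2 e A G t :
  hold e (∀ m n, Nat m ∧ Nat n ∧ A m ∧ A n ⇒ G m n)%fm t <->
  near t (fun s => forall m n,
    hold (numN n :: numN m :: e) (A (length e)) s ->
    hold (numN n :: numN m :: e) (A (S (length e))) s ->
    hold (numN n :: numN m :: e) (G (length e) (S (length e))) s).
Proof.
  rewrite hold_all; split.
  - apply near_mono; intros s H m n HA1 HA2; specialize (H (numN m)).
    rewrite hold_all_imp in H; apply near_here in H; apply H.
    rewrite !hold_and, !(cls_iff _ _ _ _ _ _ (cls_Nat X)) by len; lks.
    repeat split; auto; eexists; apply eqn_refl.
  - apply near_open; intros s H u; rewrite hold_all_imp; revert H; apply near_mono.
    intros r H v Hv.
    rewrite !hold_and, !(cls_iff _ _ _ _ _ _ (cls_Nat X)) in Hv by len; lks_in Hv.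
    destruct Hv as ([m Em] & [n En] & H1 & H2).
    assert (E : Forall2 (fun v v' => eqn v v' r) (v :: u :: e) (numN n :: numN m :: e))
      by (repeat constructor; auto; apply Forall2_eqn_refl).
    assert (E' : Forall2 (fun v v' => eqn v v' r) (numN n :: numN m :: e) (v :: u :: e))
      by (repeat constructor; try apply eqn_sym; auto; apply Forall2_eqn_refl).
    apply (hold_congr _ _ _ _ _ E'), H; [revert H1|revert H2]; apply hold_congr, E.
Qed.

Lemma FunS_near P R F t : FunS P R F t -> near t (FunS P R F).
Proof. apply near_near. Qed.

Lemma val_congr F u v u' v' t :
  eqn u u' t -> eqn v v' t -> val F u v t -> val F u' v' t.
Proof.
  intros Eu Ev [Hm Hu]; split.
  - apply mem_eqn_l with (opairN u v); auto; apply eqn_opair; auto.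
  - intros w Hw; apply eqn_trans with v; auto; apply Hu.
    apply mem_eqn_l with (opairN u' w); auto; apply eqn_opair.
    split; [apply eqn_sym; auto|apply eqn_refl].
Qed.

Lemma val_congr_fun F G u v t : eqn F G t -> val F u v t -> val G u v t.
Proof.
  intros E [Hm Hu]; split; [apply mem_eqn_r with F; auto|].
  intros w Hw; apply Hu, mem_eqn_r with G; auto; apply eqn_sym; auto.
Qed.

Lemma FunS_range_val {I J : Type} A B (a : I -> name X) (b : J -> name X) F t :
  cls A (range a) -> cls B (range b) -> FunS (range a) (range b) F t ->
  forall i, exists j, val F (a i) (b j) t.
Proof.
  intros HA HB HF i.
  destruct (FunS_val _ _ _ _ _ _ (a i) t HA HB HF) as (v & [j E] & Hv).
  { exists i; apply eqn_refl. }
  exists j; revert Hv; apply val_congr; [apply eqn_refl|exact E].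
Qed.

Lemma seq_val F t : FunS isNat isRat F t ->
  forall n, exists q, val F (numN n) (ratN q) t.
Proof. intros H; exact (FunS_range_val _ _ _ _ _ _ (cls_Nat X) (cls_Rat X) H). Qed.

(** Stated for all values of [F n] and [F' m] instead of the values, so that it
    makes sense for every name. *)
Definition gap F n F' m (c : Q) t : Prop := forall p q,
  val F (numN n) (ratN p) t -> val F' (numN m) (ratN q) t -> (Qabs (p - q) < c)%Q.

Lemma hold_gap a b i j d e F F' n m c t :
  FunS isNat isRat F t -> FunS isNat isRat F' t ->
  den a e F t -> den b e F' t -> den i e (numN n) t -> den j e (numN m) t ->
  den d e (ratN c) t ->
  (hold e (qlt (qabs (qsub (ap a i) (ap b j))) d) t <-> gap F n F' m c t).
Proof.
  intros HF HF' Ha Hb Hi Hj Hd.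
  destruct (seq_val F t HF n) as [p Hp], (seq_val F' t HF' m) as [q Hq].
  rewrite (hold_qlt _ _ _ _ (Qabs (p - q)) c); [|apply den_qabs, den_qsub|exact Hd];
    [|apply (den_ap _ _ _ _ F (numN n)); auto|apply (den_ap _ _ _ _ F' (numN m)); auto].
  split; [|intros H; apply H; auto].
  intros H p' q' Hp' Hq'.
  pose proof (val_unique _ _ _ _ _ _ Hp' Hp) as E1; apply eqn_rat in E1.
  pose proof (val_unique _ _ _ _ _ _ Hq' Hq) as E2; apply eqn_rat in E2.
  rewrite E1, E2; exact H.
Qed.

Definition posQ : Type := {q : Q | (0 < q)%Q}.

Definition CauchyS F t : Prop := FunS isNat isRat F t /\
  near t (fun s => forall eps : posQ, exists N, near s (fun r =>
    forall m n, N < m -> N < n -> gap F n F m (proj1_sig eps) r)).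

Lemma and_iff_on (P R R' : Prop) : (P -> (R <-> R')) -> (P /\ R <-> P /\ R').
Proof. tauto. Qed.

Lemma cls_CauchySeq : cls CauchySeq CauchyS.
Proof.
  intros e x t Hx; unfold CauchySeq, CauchyS.
  rewrite hold_and, (cls_iff _ _ _ _ _ _ (cls_Fun _ _ _ _ _ (cls_Nat X) (cls_Rat X)) Hx).
  apply and_iff_on; intros HF.
  rewrite (hold_all_range _ _ _ _ _ _ (cls_Ratpos X)).
  apply (near_iff_on _ _ _ _ (FunS_near _ _ _ _ HF)); clear t HF; intros t HF.
  apply near_here in HF.
  assert (K : forall eps : posQ, hold (posN eps :: e)
     (∃ N, Nat N ∧ ∀ m n, Nat m ∧ Nat n ∧ N ∈ m ∧ N ∈ n ⇒
        qlt (qabs (qsub (ap (var x) n) (ap (var x) m))) (var (length e)))%fm t <->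
    exists N, near t (fun r =>
      forall m n, N < m -> N < n -> gap (lk e x) n (lk e x) m (proj1_sig eps) r)).
  { intros eps; rewrite (hold_ex_range _ _ _ _ _ _ (cls_Nat X)).
    assert (Hn : forall N, hold (numN N :: posN eps :: e)
      (∀ m n, Nat m ∧ Nat n ∧ S (length e) ∈ m ∧ S (length e) ∈ n ⇒
         qlt (qabs (qsub (ap (var x) n) (ap (var x) m))) (var (length e)))%fm t <-> near t (fun r =>
      forall m n, N < m -> N < n -> gap (lk e x) n (lk e x) m (proj1_sig eps) r)).
    { intros N; rewrite (hold_all_nat2 _ (fun m => fmem (S (length e)) m)).
      apply (near_iff_on _ _ _ _ (FunS_near _ _ _ _ HF)); clear t HF; intros t HF.
      apply near_here in HF.
      assert (K : forall m n,
        (hold (numN n :: numN m :: numN N :: posN eps :: e)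
          (qlt (qabs (qsub (ap (var x) (var (3 + length e)))
                 (ap (var x) (var (2 + length e))))) (var (length e))) t <->
        gap (lk e x) n (lk e x) m (proj1_sig eps) t)).
      { intros m n; apply hold_gap; auto; dvar. }
      split; intros H m n; specialize (H m n); rewrite !hold_mem in *;
        [intros H1 H2|lks; intros H1 H2]; lks_in H.
      - apply K, H; apply mem_num_num; auto.
      - apply K, H; eapply mem_num_num; eassumption. }
    split; intros [N HN]; exists N; apply Hn; exact HN. }
  split; intros H eps; apply K, H.
Qed.

Definition ModulusS f F t : Prop := FunS (range posN) isNat f t /\
  near t (fun s => forall (eps : posQ) m n N, val f (posN eps) (numN N) s ->
    N < m -> N < n -> gap F n F m (proj1_sig eps) s).

Lemma hold_Modulus e f x t : f < length e -> x < length e ->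
  FunS isNat isRat (lk e x) t ->
  (hold e (Modulus f x) t <-> ModulusS (lk e f) (lk e x) t).
Proof.
  intros Hf Hx HF; unfold Modulus, ModulusS.
  rewrite hold_and, (cls_iff _ _ _ _ _ _ (cls_Fun _ _ _ _ _ (cls_Ratpos X) (cls_Nat X)) Hf).
  apply and_iff_on; intros Hfun.
  rewrite (hold_all_range _ _ _ _ _ _ (cls_Ratpos X)).
  pose proof (near_and _ _ _ (FunS_near _ _ _ _ HF) (FunS_near _ _ _ _ Hfun)) as HC.
  rewrite <- (near_all_near t (fun (eps : posQ) s => forall m n N,
    val (lk e f) (posN eps) (numN N) s ->
    N < m -> N < n -> gap (lk e x) n (lk e x) m (proj1_sig eps) s)).
  apply (near_iff_on _ _ _ _ HC); clear t HF Hfun HC; intros t HC.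
  assert (K : forall eps : posQ, hold (posN eps :: e)
    (∀ m n, Nat m ∧ Nat n ∧ tmem (ap (var f) (var (length e))) m ∧
        tmem (ap (var f) (var (length e))) n ⇒
       qlt (qabs (qsub (ap (var x) n) (ap (var x) m))) (var (length e)))%fm t <-> near t (fun s => forall m n N,
    val (lk e f) (posN eps) (numN N) s ->
    N < m -> N < n -> gap (lk e x) n (lk e x) m (proj1_sig eps) s)).
  { intros eps; rewrite (hold_all_nat2 _
      (fun m => tmem (ap (var f) (var (length e))) (var m))).
    apply (near_iff_on _ _ _ _ HC); clear t HC; intros t HC.
    apply near_here in HC; destruct HC as [HF Hfun].
    assert (K : forall m n,
      (hold (numN n :: numN m :: posN eps :: e)
        (qlt (qabs (qsub (ap (var x) (var (2 + length e)))
               (ap (var x) (var (1 + length e))))) (var (length e))) t <->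
      gap (lk e x) n (lk e x) m (proj1_sig eps) t)).
    { intros m n; apply hold_gap; auto; dvar. }
    destruct (FunS_range_val _ _ _ _ _ _ (cls_Ratpos X) (cls_Nat X) Hfun eps) as [N HN].
    assert (KA : forall m n k x', x' < S (S (S (length e))) ->
      lk (numN n :: numN m :: posN eps :: e) x' = numN k ->
      (hold (numN n :: numN m :: posN eps :: e)
        (tmem (ap (var f) (var (length e))) (var x')) t <-> N < k)).
    { intros m n k x' Hx' E; rewrite <- (mem_num_num X) with (t := t).
      apply hold_tmem; [|apply den_var_eq; auto].
      apply (den_ap _ _ _ _ (lk e f) (posN eps)); auto; dvar. }
    split; intros H m n; specialize (H m n).
    - intros N' HN' H1 H2.
      pose proof (val_unique _ _ _ _ _ _ HN' HN) as E; apply eqn_num in E; subst N'.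
      apply K, H; [apply (KA m n m)|apply (KA m n n)]; auto; try len; lks; reflexivity.
    - intros H1 H2; apply K, (H N HN).
      + apply (KA m n m) in H1; auto; try len; lks; reflexivity.
      + apply (KA m n n) in H2; auto; try len; lks; reflexivity. }
  split; intros H eps; apply K, H.
Qed.

Definition SeqModPairS v t : Prop := exists F f,
  CauchyS F t /\ ModulusS f F t /\ eqn v (opairN F f) t.

Lemma cls_SeqModPair : cls SeqModPair SeqModPairS.
Proof.
  intros e x t Hx; unfold SeqModPair; rewrite hold_ex.
  assert (K : forall F f, (hold (f :: F :: e)
    (fand (CauchySeq (length e)) (fand (Modulus (S (length e)) (length e))
      (opair (var (length e)) (var (S (length e))) x))) t <->
    CauchyS F t /\ ModulusS f F t /\ eqn (lk e x) (opairN F f) t)).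
  { intros F f; rewrite !hold_and, (cls_iff _ _ _ _ _ _ cls_CauchySeq) by len; lks.
    apply and_iff_on; intros [HF _].
    rewrite hold_Modulus by (first [len|lks; exact HF]); lks.
    rewrite (den_unfold _ _ _ (opairN F f)); [lks; reflexivity|apply den_opair; dvar|len]. }
  split.
  - intros [F H]; rewrite hold_ex in H; destruct H as [f H]; exists F, f; apply K, H.
  - intros (F & f & H); exists F; rewrite hold_ex; exists f; apply K, H.
Qed.

(** ** Constant sequences *)

Definition constN (q : Q) : name X :=
  graphN numN (fun _ : unit => ratN q) (fun _ _ _ => True).

Lemma val_constN q n t : val (constN q) (numN n) (ratN q) t.
Proof.
  apply (val_graph _ _ _ numN (fun _ : unit => ratN q)) with (j := tt);
    [intros; apply eqn_refl|apply near_top; auto].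
Qed.

Lemma FunS_constN q t : FunS isNat isRat (constN q) t.
Proof.
  apply FunS_graph.
  - intros; apply eqn_refl.
  - intros i s; exists tt; apply near_top; auto.
  - intros j s; exists q; apply eqn_refl.
Qed.

Lemma eqn_constN F q t : eqn F (constN q) t <->
  FunS isNat isRat F t /\ near t (fun s => forall n, val F (numN n) (ratN q) s).
Proof.
  split.
  - intros E; apply eqn_sym in E; split.
    + apply (cls_congr _ _ _ _ _ _ (cls_Fun _ _ _ _ _ (cls_Nat X) (cls_Rat X)) E).
      apply FunS_constN.
    + apply eqn_near in E; revert E; apply near_mono; intros s E n.
      apply (val_congr_fun _ _ _ _ _ E), val_constN.
  - intros [HF Hv]; apply eqn_ext.
    apply (near_imp _ _ _ _ (near_and _ _ _ HF Hv)); clear HF Hv.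
    intros s [[HF _] Hv] p; split; intros Hp.
    + destruct (HF p Hp) as (x & y & [n En] & _ & E).
      apply mem_eqn_l with (opairN (numN n) (ratN q)); [|apply val_constN].
      apply eqn_sym, (eqn_trans _ _ _ _ _ E), eqn_opair; split; auto.
      apply (proj2 (Hv n)), mem_eqn_l with p; auto; apply (eqn_trans _ _ _ _ _ E), eqn_opair.
      split; auto; apply eqn_refl.
    + apply mem_char in Hp; destruct Hp as ([n []] & _ & E); cbn in E.
      apply mem_eqn_l with (opairN (numN n) (ratN q)); [apply eqn_sym; auto|apply Hv].
Qed.

Lemma hold_teq_ap a b c e F n q t : FunS isNat isRat F t ->
  den a e F t -> den b e (numN n) t -> den c e (ratN q) t ->
  (hold e (teq (ap a b) c) t <-> val F (numN n) (ratN q) t).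
Proof.
  intros HF Ha Hb Hc; destruct (seq_val F t HF n) as [p Hp].
  rewrite (hold_teq _ _ _ _ (ratN p) (ratN q)); [|apply (den_ap _ _ _ _ F (numN n)); auto|auto].
  split; intros H.
  - revert Hp; apply val_congr; [apply eqn_refl|exact H].
  - exact (val_unique _ _ _ _ _ _ Hp H).
Qed.

Lemma hold_constant a e q z t : z < length e ->
  (forall n s, den (a (length e)) (numN n :: e) (ratN q) s) ->
  (hold e (Fun Nat Rat z ∧ ∀ n, Nat n ⇒ teq (ap (var z) n) (a n))%fm t <->
   eqn (lk e z) (constN q) t).
Proof.
  intros Hz Ha; rewrite hold_and, eqn_constN.
  rewrite (cls_iff _ _ _ _ _ _ (cls_Fun _ _ _ _ _ (cls_Nat X) (cls_Rat X)) Hz).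
  apply and_iff_on; intros HF; rewrite (hold_all_range _ _ _ _ _ _ (cls_Nat X)).
  apply (near_iff_on _ _ _ _ (FunS_near _ _ _ _ HF)); clear t HF; intros t HF.
  apply near_here in HF; split; intros H n; specialize (H n); revert H;
    apply (hold_teq_ap _ _ _ _ (lk e z) n q); auto; dvar.
Qed.

Lemma den_const a e q t : den a e (ratN q) t -> den (const a) e (constN q) t.
Proof.
  intros Ha l z Hz; unfold const.
  rewrite (hold_bind _ _ _ (ratN q)) by apply den_app, Ha.
  rewrite (hold_constant (fun _ => var (length (l ++ e))) _ q); [lks; reflexivity|len|].
  intros; dvar.
Qed.

Lemma den_dist_const a b e p q t : den a e (constN p) t -> den b e (constN q) t ->
  den (dist a b) e (constN (Qabs (p - q))) t.
Proof.
  intros Ha Hb l z Hz; unfold dist.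
  rewrite (hold_bind _ _ _ (constN p)) by apply den_app, Ha.
  rewrite (hold_bind _ _ _ (constN q)) by apply den_cons, den_app, Hb.
  rewrite (hold_constant (fun n => qabs (qsub (ap (var (length (l ++ e))) (var n))
    (ap (var (S (length (l ++ e)))) (var n)))) _ (Qabs (p - q)));
    [lks; reflexivity|len|].
  intros n s; apply den_qabs, den_qsub; eapply den_ap; try apply (val_constN _ n); dvar.
Qed.

Lemma Qinv_nat_lt (c : Q) : (0 < c)%Q -> exists k, (1 # Pos.of_succ_nat k < c)%Q.
Proof.
  destruct c as [n d]; unfold Qlt; cbn [Qnum Qden]; intros H.
  exists (Pos.to_nat d).
  change (Z.pos (Pos.of_succ_nat (Pos.to_nat d))) with (Z.of_nat (S (Pos.to_nat d))).
  nia.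
Qed.

Lemma hold_slt_const a b e p q t : den a e (constN p) t -> den b e (constN q) t ->
  (p < q)%Q -> hold e (slt a b) t.
Proof.
  intros Ha Hb Hpq; unfold slt.
  rewrite (hold_bind _ _ _ (constN p)) by apply Ha.
  rewrite (hold_bind _ _ _ (constN q)) by apply den_cons, Hb.
  destruct (Qinv_nat_lt (q - p)) as [k Hk]; [lra|].
  rewrite hold_ex; exists (numN (S k)); rewrite hold_ex; exists (numN 0).
  rewrite !hold_and, (cls_iff _ _ _ _ _ _ (cls_Natpos X)),
    (cls_iff _ _ _ _ _ _ (cls_Nat X)) by len; lks.
  split; [exists k; apply eqn_refl|split; [exists 0; apply eqn_refl|]].
  rewrite (hold_all_nat1 _ (fmem _)); apply near_top; intros s n _.
  apply (hold_qlt _ _ _ _ (p + (1 # Pos.of_succ_nat k)) q); [| |lra].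
  - apply den_qadd; [eapply den_ap; try apply (val_constN _ n); dvar|].
    apply den_qinv_nat; dvar.
  - eapply den_ap; try apply (val_constN _ n); dvar.
Qed.

Lemma hold_slt_dist a b c e p F q t : FunS isNat isRat F t ->
  den a e (constN p) t -> den b e F t -> den c e (ratN q) t ->
  hold e (slt (dist a b) (const c)) t ->
  exists N, forall n, N < n -> forall x, val F (numN n) (ratN x) t ->
    (Qabs (p - x) < q)%Q.
Proof.
  intros HF Ha Hb Hc H; unfold slt in H; apply hold_bind_ex in H.
  destruct H as (D & HD & H); unfold dist in HD.
  rewrite (hold_bind _ _ _ (constN p)) in HD by apply den_cons, Ha.
  rewrite (hold_bind _ _ _ F) in HD by (do 2 apply den_cons; apply Hb).
  rewrite hold_and, (hold_all_range _ _ _ _ _ _ (cls_Nat X)) in HD.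
  destruct HD as [HD HDv]; apply near_here in HDv.
  apply (cls_iff _ _ _ _ _ _ (cls_Fun _ _ _ _ _ (cls_Nat X) (cls_Rat X))) in HD;
    [|len]; lks_in HD.
  rewrite (hold_bind _ _ _ (constN q)) in H by apply den_const, den_cons, Hc.
  rewrite hold_ex in H; destruct H as [m H]; rewrite hold_ex in H.
  destruct H as [v H]; rewrite !hold_and, (cls_iff _ _ _ _ _ _ (cls_Natpos X)),
    (cls_iff _ _ _ _ _ _ (cls_Nat X)) in H by len; lks_in H.
  destruct H as ([k Ek] & [N EN] & H); exists N; intros n Hn x Hx.
  rewrite (hold_all_nat1 _ (fmem _)) in H; apply near_here in H; specialize (H n).
  rewrite hold_mem in H; lks_in H.
  specialize (H (mem_eqn_l _ _ _ _ _ (eqn_sym _ _ _ _ EN)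
    (proj2 (mem_num_num X N n t) Hn))).
  specialize (HDv n).
  rewrite (hold_teq_ap _ _ _ _ D n (Qabs (p - x))) in HDv; [|exact HD|dvar|dvar|].
  - apply (hold_qlt _ _ _ _ (Qabs (p - x) + (1 # Pos.of_succ_nat k)) q) in H.
    + assert (0 < 1 # Pos.of_succ_nat k)%Q by reflexivity; lra.
    + apply den_qadd; [apply (den_ap _ _ _ _ D (numN n)); auto; dvar|].
      apply den_qinv_nat, den_eqn with (1 := Ek); dvar.
    + eapply den_ap; try apply (val_constN _ n); dvar.
  - apply den_qabs, den_qsub; eapply den_ap; [dvar|dvar|apply val_constN|dvar|dvar|].
    exact Hx.
Qed.

End Sequences.

Arguments gap {X}. Arguments CauchyS {X}. Arguments ModulusS {X}. Arguments constN {X}.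
Arguments SeqModPairS {X}.

(** * A locally constant sequence of rationals *)

Section LocallyConstant.
Variable X : space.
Implicit Types (t s r : pt X) (u v w F : name X) (e l : list (name X)).
Notation isNat := (range (X:=X) numN).
Notation isRat := (range (X:=X) ratN).

Variable a : nat -> pt X -> Q.

(** Near [t] the limit of [a] can be approximated by a rational, up to any given
    [eps], on a relatively clopen set [F] that contains [t].  It is essential
    that the neighbourhood [U] comes before [eps]: for a single [eps] one could
    take [U] so small that [F = U] works. *)
Definition approximable t : Prop := exists U : pt X -> Prop, near t U /\
  forall eps : posQ, exists (F : pt X -> Prop) (q : Q), F t /\
    (forall s, U s -> near s F \/ near s (fun r => ~ F r)) /\
    (forall s, U s -> F s -> exists N, forall n, N < n ->
       (Qabs (a n s - q) < proj1_sig eps)%Q).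

Definition halved (eps : posQ) : posQ.
Proof. exists (proj1_sig eps * (1 # 2))%Q; destruct eps as [q Hq]; cbn [proj1_sig]; lra. Defined.

(** Let [N0] be the value at [t] of the modulus [f] for [eps / 2], and let [q0]
    be the next term [F (N0 + 1)].  As natural numbers and rationals of the
    model are locally constant, the set where [f] and [F] take these two values
    is open, and so is its complement.  On it the limit of [F] is within [eps]
    of [q0]. *)
Lemma approximable_of_modulus f F t :
  FunS isNat isRat F t -> ModulusS f F t ->
  near t (fun s => forall eps : posQ, exists J, forall j, J < j ->
    exists K, forall k, K < k -> forall q, val F (numN k) (ratN q) s ->
      (Qabs (a j s - q) < proj1_sig eps)%Q) ->
  approximable t.
Proof.
  intros HF [Hf Hmod] Hconv.
  pose proof (near_and _ _ _ (near_and _ _ _ (FunS_near _ _ _ _ _ HF)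
    (FunS_near _ _ _ _ _ Hf)) (near_and _ _ _ Hmod Hconv)) as HU.
  clear Hmod Hconv; eexists; split; [exact HU|]; intros eps.
  set (e2 := halved eps).
  destruct (FunS_range_val _ _ _ _ _ _ _ (cls_Ratpos X) (cls_Nat X) Hf e2) as [N0 HN0].
  destruct (seq_val _ _ _ HF (S N0)) as [q0 Hq0].
  exists (fun s => val f (posN e2) (numN N0) s /\ val F (numN (S N0)) (ratN q0) s), q0.
  split; [auto|]; clear t HF Hf HU HN0 Hq0; split.
  - intros t ((HF & Hf) & _ & _).
    destruct (FunS_range_val _ _ _ _ _ _ _ (cls_Ratpos X) (cls_Nat X) Hf e2) as [N HN].
    destruct (seq_val _ _ _ HF (S N0)) as [q Hq].
    apply (val_near _ _ _ _ _ _ _ Hf) in HN;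
      [|apply near_top; intros s; eexists; apply eqn_refl].
    apply (val_near _ _ _ _ _ _ _ HF) in Hq;
      [|apply near_top; intros s; eexists; apply eqn_refl].
    destruct (classic (N = N0 /\ q == q0)) as [[-> E]|H]; [left|right];
      apply (near_imp _ _ _ _ (near_and _ _ _ HN Hq)); intros s [H1 H2].
    + split; auto; revert H2; apply val_congr; [apply eqn_refl|apply eqn_rat, E].
    + intros [H3 H4]; apply H; split.
      * pose proof (val_unique _ _ _ _ _ _ H1 H3) as E; apply eqn_num in E; exact E.
      * pose proof (val_unique _ _ _ _ _ _ H2 H4) as E; apply eqn_rat in E; exact E.
  - intros t ((HF & Hf) & Hmod & Hconv) [HN0 Hq0].
    destruct (Hconv e2) as [J HJ]; exists J; intros j Hj.
    destruct (HJ j Hj) as [K HK].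
    destruct (seq_val _ _ _ HF (S (K + N0))) as [q Hq].
    specialize (HK (S (K + N0)) ltac:(lia) q Hq).
    pose proof (Hmod e2 (S (K + N0)) (S N0) N0 HN0 ltac:(lia) ltac:(lia) q0 q Hq0 Hq)
      as Hgap.
    change (proj1_sig e2) with (proj1_sig eps * (1 # 2))%Q in *; apply Qabs_Qlt_condition in HK, Hgap.
    apply Qabs_Qlt_condition; lra.
Qed.

Hypothesis a_const : forall n t, near t (fun s => a n s = a n t).
Hypothesis a_cauchy : forall t (eps : posQ), exists N, near t (fun s =>
  forall m n, N < m -> N < n -> (Qabs (a n s - a m s) < proj1_sig eps)%Q).

(** The functions [a n] being locally constant, each set where [a n] has a given
    value is open, so that [c] applied to them is a function of the model. *)
Definition along (c : Q -> name X) : name X :=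
  graphN numN c (fun n q s => a n s = q).

Lemma along_uniq (c : Q -> name X) i i' q q' s : eqn (X:=X) (numN i) (numN i') s ->
  near s (fun r => a i r = q) -> near s (fun r => a i' r = q') -> eqn (c q) (c q') s.
Proof.
  intros E H H'; apply eqn_num in E; subst i'; apply near_here in H, H'.
  rewrite <- H, <- H'; apply eqn_refl.
Qed.

Lemma val_along c n t : val (along c) (numN n) (c (a n t)) t.
Proof. apply val_graph; [apply along_uniq|apply a_const]. Qed.

Lemma FunS_along c P t : (forall q s, P (c q) s) -> FunS isNat P (along c) t.
Proof.
  intros H; apply FunS_graph; [apply along_uniq| |exact H].
  intros n s; exists (a n s); apply a_const.
Qed.

Lemma FunS_along_rat t : FunS isNat isRat (along ratN) t.
Proof. apply FunS_along; intros q s; exists q; apply eqn_refl. Qed.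

Lemma val_along_rat n q t : val (along ratN) (numN n) (ratN q) t -> q == a n t.
Proof.
  intros H; pose proof (val_unique _ _ _ _ _ _ H (val_along ratN n t)) as E.
  apply eqn_rat in E; exact E.
Qed.

Lemma along_Cauchy t : CauchyS (along ratN) t.
Proof.
  split; [apply FunS_along_rat|]; apply near_top; intros s eps.
  destruct (a_cauchy s eps) as [N HN]; exists N; revert HN; apply near_mono.
  intros r H m n Hm Hn p q Hp Hq; apply val_along_rat in Hp, Hq.
  rewrite Hp, Hq; auto.
Qed.

Theorem modulus_approximates t :
  hold [] (∀ x, CauchySeq x ⇒ ∃ f, Modulus f x)%fm t ->
  approximable t.
Proof.
  rewrite hold_all_imp; intros H; apply near_here in H; specialize (H (along ratN)).
  rewrite (cls_iff _ _ _ _ _ _ (cls_CauchySeq X)) in H by len; lks_in H.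
  specialize (H (along_Cauchy t)); rewrite hold_ex in H; destruct H as [f H].
  pose proof (FunS_along_rat t) as HF.
  rewrite hold_Modulus in H by (first [len|lks; exact HF]); lks_in H.
  apply (approximable_of_modulus f (along ratN)); auto.
  apply near_top; intros s eps; destruct (a_cauchy s eps) as [N HN].
  apply near_here in HN; exists N; intros j Hj; exists N; intros k Hk q Hq.
  apply val_along_rat in Hq; rewrite Hq; auto.
Qed.

(** ** The terms as constant sequences with a modulus *)

(** A modulus that works for every constant sequence. *)
Definition zeroN : name X :=
  graphN posN (fun _ : unit => numN 0) (fun _ _ _ => True).
Definition pairN (q : Q) : name X := opairN (constN q) zeroN.

Lemma val_constN_rat q p n t : val (X:=X) (constN q) (numN n) (ratN p) t -> p == q.
Proof.
  intros H; pose proof (val_unique _ _ _ _ _ _ H (val_constN X q n t)) as E.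
  apply eqn_rat in E; exact E.
Qed.

Lemma constN_gap q m n (eps : posQ) t : gap (constN q) n (constN q) m (proj1_sig eps) t.
Proof.
  intros p p' Hp Hp'; apply val_constN_rat in Hp, Hp'; destruct eps as [c Hc]; cbn [proj1_sig].
  apply Qabs_Qlt_condition; lra.
Qed.

Lemma constN_Cauchy q t : CauchyS (constN q) t.
Proof.
  split; [apply FunS_constN|]; apply near_top; intros s eps; exists 0.
  apply near_top; intros r m n _ _; apply constN_gap.
Qed.

Lemma pairN_SeqModPair q t : SeqModPairS (pairN q) t.
Proof.
  exists (constN q), zeroN; split; [apply constN_Cauchy|]; split; [|apply eqn_refl].
  split.
  - apply FunS_graph.
    + intros; apply eqn_refl.
    + intros i s; exists tt; apply near_top; auto.
    + intros i s; exists 0; apply eqn_refl.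
  - apply near_top; intros s eps m n N _ _ _; apply constN_gap.
Qed.

Lemma hold_firsts e t p : p < length e -> lk e p = along pairN ->
  hold (along constN :: e) (firsts p (length e)) t.
Proof.
  intros Hp Ep; unfold firsts; rewrite hold_and; split.
  - apply (cls_iff _ _ _ _ _ _ (cls_Fun _ _ _ _ _ (cls_Nat X) (cls_CauchySeq X)));
      [len|]; lks; apply FunS_along; intros; apply constN_Cauchy.
  - rewrite (hold_all_range _ _ _ _ _ _ (cls_Nat X)); apply near_top; intros s n.
    rewrite hold_ex; exists zeroN.
    apply (hold_teq _ _ _ _ (pairN (a n s)) (pairN (a n s))); [| |apply eqn_refl].
    + eapply den_ap; [|dvar|apply val_along]; apply den_var_eq; [len|lks; exact Ep].
    + apply den_opair; [|dvar]; eapply den_ap; [dvar|dvar|].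
      apply (val_along constN).
Qed.

(** The hypothesis describes [W] only through equalities of pairs, so that its
    values are found by the injectivity of pairing. *)
Lemma firsts_val e t p n W : p < length e -> n < length e ->
  lk e p = along pairN -> lk e n = W -> hold e (firsts p n) t ->
  near t (fun s => forall j, val W (numN j) (constN (a j s)) s).
Proof.
  intros Hp Hw Ep Ew; unfold firsts; rewrite hold_and.
  rewrite (cls_iff _ _ _ _ _ _ (cls_Fun _ _ _ _ _ (cls_Nat X) (cls_CauchySeq X)) Hw).
  rewrite (hold_all_range _ _ _ _ _ _ (cls_Nat X)), Ew.
  intros [HF H]; apply (near_imp _ _ _ _ (near_and _ _ _ (FunS_near _ _ _ _ _ HF) H)).
  clear t HF H; intros t [HF H] j; specialize (H j).
  destruct (FunS_val _ _ _ _ _ _ (numN j) t (cls_Nat X) (cls_CauchySeq X) HF)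
    as (v & _ & Hv); [exists j; apply eqn_refl|].
  rewrite hold_ex in H; destruct H as [f H].
  rewrite (hold_teq _ _ _ _ (pairN (a j t)) (opairN v f)) in H.
  - unfold pairN in H; rewrite eqn_opair in H; destruct H as [H _].
    revert Hv; apply val_congr; [apply eqn_refl|apply eqn_sym, H].
  - eapply den_ap; [|dvar|apply val_along]; apply den_var_eq; [len|lks; exact Ep].
  - apply den_opair; [|dvar]; eapply den_ap; [|dvar|exact Hv].
    apply den_var_eq; [len|lks; exact Ew].
Qed.

Lemma hold_CauchyOfPairs e t p : p < length e -> lk e p = along pairN ->
  hold e (CauchyOfPairs p) t.
Proof.
  intros Hp Ep; unfold CauchyOfPairs, bind; rewrite hold_ex; exists (along constN).
  rewrite hold_and; split; [apply hold_firsts; auto|]; unfold CauchyOfSeqs.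
  rewrite (hold_all_range _ _ _ _ _ _ (cls_Ratpos X)); apply near_top; intros s eps.
  rewrite (hold_ex_range _ _ _ _ _ _ (cls_Nat X)).
  destruct (a_cauchy s eps) as [N HN]; exists N.
  rewrite (hold_all_nat2 _ _ (fmem _)); revert HN; apply near_mono; intros r HN j k.
  rewrite !hold_mem; lks; rewrite !mem_num_num; intros Hj Hk.
  apply (hold_slt_const _ _ _ _ (Qabs (a j r - a k r)) (proj1_sig eps)).
  - apply den_dist_const; (eapply den_ap; [dvar|dvar|apply (val_along constN)]).
  - apply den_const; dvar.
  - apply HN; auto.
Qed.

Theorem pairs_approximate t :
  hold [] (∀ P, Fun Nat SeqModPair P ∧ CauchyOfPairs P ⇒
    ∃ Y, CauchySeq Y ∧ (∃ f, Modulus f Y) ∧ ConvergesPairs P Y)%fm t ->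
  approximable t.
Proof.
  rewrite hold_all_imp; intros H; apply near_here in H; specialize (H (along pairN)).
  rewrite hold_and, (cls_iff _ _ _ _ _ _
    (cls_Fun _ _ _ _ _ (cls_Nat X) (cls_SeqModPair X))), hold_ex in H by len.
  lks_in H; destruct H as [F H].
  { split; [apply FunS_along; intros; apply pairN_SeqModPair|].
    apply hold_CauchyOfPairs; [len|lks; reflexivity]. }
  rewrite !hold_and, (cls_iff _ _ _ _ _ _ (cls_CauchySeq X)) in H by len; lks_in H.
  destruct H as ((HF & _) & Hmod & Hconv).
  rewrite hold_ex in Hmod; destruct Hmod as [f Hmod].
  rewrite hold_Modulus in Hmod by (first [len|lks; exact HF]); lks_in Hmod.
  apply (approximable_of_modulus f F); auto.
  unfold ConvergesPairs in Hconv; apply hold_bind_ex in Hconv.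
  destruct Hconv as (W & HW & Hconv).
  apply (firsts_val _ _ _ _ W) in HW; [|len|len|lks; reflexivity|lks; reflexivity].
  unfold ConvergesSeqs in Hconv.
  rewrite (hold_all_range _ _ _ _ _ _ (cls_Ratpos X)) in Hconv.
  apply (near_imp _ _ _ _ (near_and _ _ _ (FunS_near _ _ _ _ _ HF)
    (near_and _ _ _ HW Hconv))).
  clear t HF Hmod HW Hconv; intros t (HF & HW & Hconv) eps; specialize (Hconv eps).
  rewrite (hold_ex_range _ _ _ _ _ _ (cls_Nat X)) in Hconv.
  destruct Hconv as [J HJ]; exists J; intros j Hj.
  rewrite (hold_all_nat1 _ _ (fmem _)) in HJ; apply near_here in HJ; specialize (HJ j).
  rewrite hold_mem in HJ; lks_in HJ; rewrite mem_num_num in HJ; specialize (HJ Hj).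
  apply (hold_slt_dist _ _ _ _ _ (a j t) F (proj1_sig eps)) in HJ; auto; try dvar.
  eapply den_ap; [dvar|dvar|apply HW].
Qed.

End LocallyConstant.

Arguments approximable {X}.

(** * The summable ideal *)

Definition unitfrac (i : nat) : Q := 1 # Pos.of_succ_nat i.

Lemma unitfrac_pos i : (0 < unitfrac i)%Q.
Proof. reflexivity. Qed.

Lemma unitfrac_anti i j : i <= j -> (unitfrac j <= unitfrac i)%Q.
Proof.
  intros H; unfold unitfrac, Qle; cbn [Qnum Qden].
  change (Z.pos (Pos.of_succ_nat i)) with (Z.of_nat (S i)).
  change (Z.pos (Pos.of_succ_nat j)) with (Z.of_nat (S j)); lia.
Qed.

Lemma unitfrac_small (c : Q) (n : nat) : (0 < c)%Q ->
  exists k, n <= k /\ (unitfrac k < c)%Q.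
Proof.
  intros H; destruct (Qinv_nat_lt c H) as [k Hk]; exists (n + k); split; [lia|].
  apply Qle_lt_trans with (unitfrac k); [apply unitfrac_anti; lia|exact Hk].
Qed.

Fixpoint mass (s : nat -> bool) (m : nat) : Q :=
  match m with
  | 0 => 0
  | S i => mass s i + (if s i then unitfrac i else 0)
  end.

Lemma mass_mono s n m : n <= m -> (mass s n <= mass s m)%Q.
Proof.
  intros H; induction H as [|m H IH]; [lra|]; cbn [mass].
  pose proof (unitfrac_pos m); destruct (s m); lra.
Qed.

Lemma mass_ext s t n : (forall i, i < n -> s i = t i) -> mass s n = mass t n.
Proof.
  induction n as [|n IH]; intros H; cbn [mass]; [reflexivity|].
  rewrite (H n) by lia; rewrite IH by (intros; apply H; lia); reflexivity.
Qed.

(** Of the terms with indices from [n] to [2 n - 1] each is at least [1 / 2 n]. *)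
Lemma mass_diverges s n : 0 < n -> (forall i, n <= i -> s i = true) ->
  (mass s n + (1 # 2) <= mass s (n + n))%Q.
Proof.
  intros Hn H.
  assert (K : forall j, j <= n ->
    (mass s n + (Z.of_nat j # Pos.of_nat (2 * n)) <= mass s (n + j))%Q).
  { induction j as [|j IH]; intros Hj.
    - rewrite Nat.add_0_r; assert ((Z.of_nat 0 # Pos.of_nat (2 * n)) == 0)%Q
        by reflexivity; lra.
    - rewrite Nat.add_succ_r; cbn [mass]; rewrite H by lia.
      specialize (IH ltac:(lia)).
      assert (E : (Z.of_nat (S j) # Pos.of_nat (2 * n) ==
        (Z.of_nat j # Pos.of_nat (2 * n)) + (1 # Pos.of_nat (2 * n)))%Q).
      { unfold Qeq; cbn [Qnum Qden Qplus]; rewrite Pos2Z.inj_mul; lia. }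
      assert (L : (1 # Pos.of_nat (2 * n) <= unitfrac (n + j))%Q).
      { unfold unitfrac, Qle; cbn [Qnum Qden].
        change (Z.pos (Pos.of_succ_nat (n + j))) with (Z.of_nat (S (n + j))); lia. }
      lra. }
  specialize (K n (le_n n)).
  assert (E : (Z.of_nat n # Pos.of_nat (2 * n) == 1 # 2)%Q).
  { unfold Qeq; cbn [Qnum Qden]; lia. }
  lra.
Qed.

Definition summable (s : nat -> bool) : Prop := exists c, forall m, (mass s m <= c)%Q.
Definition point : Type := {s : nat -> bool | summable s}.
Definition set_of (t : point) : nat -> bool := proj1_sig t.

(** Sets that agree with [t] up to [k] and whose excess of mass over [t] is
    small.  For large [k] the mass of [t] beyond [k] is small, so that these
    neighbourhoods generate the topology of the distance in sum. *)
Definition nbhd (t : point) (k : nat) (s : point) : Prop :=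
  (forall i, i < k -> set_of s i = set_of t i) /\
  (forall m, (mass (set_of s) m <= mass (set_of t) m + unitfrac k)%Q).

Definition is_open (U : point -> Prop) : Prop :=
  forall t, U t -> exists k, forall s, nbhd t k s -> U s.

Definition interior (t : point) (P : point -> Prop) : Prop :=
  exists U, is_open U /\ U t /\ forall s, U s -> P s.

Lemma nbhd_anti t k l s : k <= l -> nbhd t l s -> nbhd t k s.
Proof.
  intros H [H1 H2]; split; [intros; apply H1; lia|].
  intros m; specialize (H2 m); pose proof (unitfrac_anti k l H); lra.
Qed.

Lemma is_open_and U V : is_open U -> is_open V -> is_open (fun s => U s /\ V s).
Proof.
  intros HU HV t [Ut Vt]; destruct (HU t Ut) as [k Hk], (HV t Vt) as [l Hl].
  exists (k + l); intros s Hs; split; [apply Hk|apply Hl];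
    apply nbhd_anti with (k + l); auto; lia.
Qed.

Definition ideal : space.
Proof.
  refine (Space point interior _ _ _ _ _).
  - intros t P Q HPQ (U & HU & Ut & H); exists U; auto.
  - intros t P H; exists (fun _ => True); split; [|auto].
    intros s _; exists 0; auto.
  - intros t P Q (U & HU & Ut & HP) (V & HV & Vt & HQ).
    exists (fun s => U s /\ V s); split; [apply is_open_and; auto|].
    split; [auto|intros s [Us Vs]; auto].
  - intros t P (U & _ & Ut & H); auto.
  - intros t P (U & HU & Ut & H); exists U; repeat split; auto.
    intros s Us; exists U; auto.
Defined.

Definition partial (n : nat) (s : pt ideal) : Q := mass (set_of s) n.

Lemma partial_const n (t : pt ideal) : near t (fun s => partial n s = partial n t).
Proof.
  exists (fun s : point => forall i, i < n -> set_of s i = set_of t i); split; [|split].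
  - intros s Hs; exists n; intros r [Hr _] i Hi; rewrite Hr, Hs; auto.
  - auto.
  - intros s Hs; apply mass_ext, Hs.
Qed.

Lemma mass_tail s (c : Q) : summable s -> (0 < c)%Q ->
  exists N, forall m, (mass s m <= mass s N + c)%Q.
Proof.
  intros [b Hb] Hc; apply NNPP; intros H.
  assert (K : forall j, exists N, (inject_Z (Z.of_nat j) * c <= mass s N)%Q).
  { induction j as [|j [N IH]]; [exists 0; change (inject_Z (Z.of_nat 0)) with 0%Q; cbn [mass]; lra|].
    apply NNPP; intros HN; apply H; exists N; intros m.
    apply Qnot_lt_le; intros Hm; apply HN; exists m.
    replace (Z.of_nat (S j)) with (Z.of_nat j + 1)%Z by lia.
    rewrite inject_Z_plus; change (inject_Z 1) with 1%Q; lra. }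
  destruct (K (S (Z.to_nat (Qceiling (b / c))))) as [N HN].
  pose proof (Qle_ceiling (b / c)) as L.
  assert (L' : (b / c < inject_Z (Z.of_nat (S (Z.to_nat (Qceiling (b / c))))))%Q).
  { apply Qle_lt_trans with (1 := L); rewrite <- Zlt_Qlt; lia. }
  apply (Qmult_lt_r _ _ c Hc) in L'.
  assert (E : (b / c * c == b)%Q) by (field; lra).
  specialize (Hb N); lra.
Qed.

(** Where the mass beyond [N] is strictly below a bound is an open set, although
    it is in general not closed. *)
Lemma partial_cauchy (t : pt ideal) (eps : posQ) : exists N, near t (fun s =>
  forall m n, N < m -> N < n -> (Qabs (partial n s - partial m s) < proj1_sig eps)%Q).
Proof.
  destruct eps as [eps Heps]; cbn [proj1_sig].
  destruct (mass_tail (set_of t) (eps * (1 # 2)) (proj2_sig t)) as [N HN]; [lra|].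
  exists N, (fun s : point => exists c, (c < eps)%Q /\
    forall m, (mass (set_of s) m <= mass (set_of s) N + c)%Q); split; [|split].
  - intros s (c & Hc & Hs); destruct (unitfrac_small (eps - c) N) as (k & Hk & Hc');
      [lra|].
    exists k; intros r [H1 H2]; exists (c + unitfrac k)%Q; split; [lra|].
    intros m; specialize (H2 m); specialize (Hs m).
    rewrite (mass_ext (set_of r) (set_of s) N) by (intros; apply H1; lia); lra.
  - exists (eps * (1 # 2))%Q; split; [lra|exact HN].
  - intros s (c & Hc & Hs) m n Hm Hn; unfold partial.
    pose proof (Hs m); pose proof (Hs n).
    pose proof (mass_mono (set_of s) N m ltac:(lia)).
    pose proof (mass_mono (set_of s) N n ltac:(lia)).
    apply Qabs_Qlt_condition; lra.
Qed.

(** ** Greedy enlargement of the empty set *)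

Lemma mass_false m : (mass (fun _ => false) m == 0)%Q.
Proof. induction m as [|m IH]; cbn [mass]; lra. Qed.

Definition emptyset : point.
Proof.
  exists (fun _ => false); exists 0%Q; intros m; rewrite mass_false; lra.
Defined.

Definition insert (i : nat) (s : nat -> bool) (j : nat) : bool :=
  if Nat.eqb j i then true else s j.

Lemma mass_insert i s m : (mass (insert i s) m <= mass s m + unitfrac i)%Q.
Proof.
  pose proof (unitfrac_pos i) as Hi.
  assert (K : forall m, m <= i -> mass (insert i s) m = mass s m).
  { intros n Hn; apply mass_ext; intros j Hj; unfold insert.
    destruct (Nat.eqb_spec j i); [lia|reflexivity]. }
  destruct (le_lt_dec m i) as [H|H]; [rewrite K by exact H; lra|].
  induction H as [|m H IH]; cbn [mass].
  - rewrite K by lia; unfold insert; rewrite Nat.eqb_refl; destruct (s i); lra.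
  - unfold insert at 2; destruct (Nat.eqb_spec m i); [lia|]; destruct (s m); lra.
Qed.

Definition add (i : nat) (s : point) : point.
Proof.
  exists (insert i (set_of s)); destruct s as [s [c Hc]]; cbn [set_of proj1_sig].
  exists (c + unitfrac i)%Q; intros m; pose proof (mass_insert i s m).
  specialize (Hc m); lra.
Defined.

Section Greedy.
Variables (G : point -> Prop) (k : nat).

Fixpoint greedy (n : nat) : point :=
  match n with
  | 0 => emptyset
  | S i => if excluded_middle_informative (k <= i /\ G (add i (greedy i)))
           then add i (greedy i) else greedy i
  end.

Definition limit (i : nat) : bool := set_of (greedy (S i)) i.

Lemma greedy_beyond n : forall i, n <= i -> set_of (greedy n) i = false.
Proof.
  induction n as [|n IH]; intros i Hi; [reflexivity|]; cbn [greedy].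
  destruct (excluded_middle_informative _); [|apply IH; lia].
  cbn; unfold insert; destruct (Nat.eqb_spec i n); [lia|apply IH; lia].
Qed.

Lemma greedy_step n i : i <> n -> set_of (greedy (S n)) i = set_of (greedy n) i.
Proof.
  intros H; cbn [greedy]; destruct (excluded_middle_informative _); [|reflexivity].
  cbn; unfold insert; destruct (Nat.eqb_spec i n); [lia|reflexivity].
Qed.

Lemma greedy_limit n i : i < n -> set_of (greedy n) i = limit i.
Proof.
  intros H; induction H as [|n H IH]; [reflexivity|].
  rewrite greedy_step by lia; exact IH.
Qed.

Lemma greedy_subset n i : set_of (greedy n) i = true -> limit i = true.
Proof.
  destruct (le_lt_dec n i) as [H|H]; [rewrite greedy_beyond by exact H; discriminate|].
  rewrite greedy_limit by exact H; auto.
Qed.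

Lemma limit_true i : limit i = true <-> k <= i /\ G (add i (greedy i)).
Proof.
  unfold limit; cbn [greedy]; destruct (excluded_middle_informative _) as [H|H].
  - split; [auto|intros _]; cbn; unfold insert; rewrite Nat.eqb_refl; reflexivity.
  - rewrite greedy_beyond by lia; split; [discriminate|contradiction].
Qed.

Lemma greedy_in n : G emptyset -> G (greedy n).
Proof.
  intros H0; induction n as [|n IH]; cbn [greedy]; auto.
  destruct (excluded_middle_informative _) as [H|H]; [apply H|exact IH].
Qed.

Lemma mass_greedy n m : (mass (set_of (greedy n)) m <= mass limit m)%Q.
Proof.
  induction m as [|m IH]; cbn [mass]; [lra|].
  pose proof (unitfrac_pos m); pose proof (greedy_subset n m) as H1.
  destruct (set_of (greedy n) m); [rewrite H1 by reflexivity; lra|].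
  destruct (limit m); lra.
Qed.

Lemma mass_limit b : (forall s, G s -> forall m, (mass (set_of s) m <= b)%Q) ->
  G emptyset -> forall m, (mass limit m <= b)%Q.
Proof.
  intros Hb H0 m; rewrite (mass_ext limit (set_of (greedy m))).
  - apply Hb, greedy_in, H0.
  - intros i Hi; symmetry; apply greedy_limit, Hi.
Qed.

End Greedy.

(** The greedy set [t] is built inside [G], the relatively clopen set [F]
    intersected with an open neighbourhood [V] of the empty set.  The bound on
    the mass keeps [t] in [V], where [F] is decided; the finite stages converge
    to [t] and lie in [F], so that [F] holds near [t]; finally the singletons
    [{i}] converge to the empty set, so that adding a large [i] to the stage
    before it also stays near [t], hence in [G]. *)
Theorem not_approximable : ~ approximable (X:=ideal) partial emptyset.
Proof.
  intros (U & (V & HV & V0 & HVU) & H).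
  destruct (HV _ V0) as [k0 Hk0].
  (* The summand 2 makes the bound [b] on the mass less than one half, the
     amount by which a block of the harmonic series grows. *)
  set (k := k0 + 2).
  assert (Hk : forall s, nbhd emptyset k s -> V s).
  { intros s Hs; apply Hk0, nbhd_anti with k; [lia|exact Hs]. }
  set (b := unitfrac k).
  assert (Hb : (0 < b * (1 # 2))%Q) by reflexivity.
  destruct (H (exist _ (b * (1 # 2))%Q Hb)) as (F & q & F0 & Hdec & Hbound).
  cbn [proj1_sig] in Hbound.
  assert (HFb : forall s : point, F s /\ V s -> forall m, (mass (set_of s) m <= b)%Q).
  { intros s [HF HVs] m.
    destruct (Hbound emptyset (HVU _ V0) F0) as [N0 HN0].
    specialize (HN0 (S N0) ltac:(lia)); unfold partial in HN0.
    apply Qabs_Qlt_condition in HN0; cbn [set_of emptyset proj1_sig] in HN0.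
    rewrite mass_false in HN0.
    destruct (Hbound s (HVU _ HVs) HF) as [N HN].
    specialize (HN (S (N + m)) ltac:(lia)); apply Qabs_Qlt_condition in HN.
    unfold partial in HN; pose proof (mass_mono (set_of s) m (S (N + m)) ltac:(lia)).
    lra. }
  set (G := fun s => F s /\ V s).
  assert (G0 : G emptyset) by (split; assumption).
  pose proof (mass_limit G k b HFb G0) as Hlim.
  set (t := exist summable (limit G k) (ex_intro _ b Hlim) : point).
  assert (Vt : V t).
  { apply Hk; split.
    - intros i Hi; cbn; destruct (limit G k i) eqn:E; [|reflexivity].
      apply limit_true in E; lia.
    - intros m; cbn [set_of emptyset proj1_sig t]; rewrite mass_false.
      pose proof (Hlim m); fold b; lra. }
  assert (Hconv : forall l n, l <= n -> nbhd t l (greedy G k n)).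
  { intros l n Hn; split; [intros i Hi; apply greedy_limit; lia|].
    intros m; pose proof (mass_greedy G k n m); pose proof (unitfrac_pos l).
    cbn [set_of t proj1_sig]; lra. }
  destruct (Hdec t (HVU _ Vt)) as [(W & HW & Wt & HWF)|(W & HW & Wt & HWF)];
    destruct (HW t Wt) as [l Hl].
  (* If [F] failed near [t], it would fail at a finite stage. *)
  2: { apply (HWF (greedy G k l)); [apply Hl, Hconv; lia|].
       apply (greedy_in G k l G0). }
  destruct (HV t Vt) as [l' Hl'].
  set (n := l + l' + k).
  assert (Hall : forall i, n <= i -> limit G k i = true).
  { intros i Hi; apply limit_true; split; [lia|].
    assert (Hn : forall j, j <= i -> nbhd t j (add i (greedy G k i))).
    { intros j Hj; destruct (Hconv j i Hj) as [H1 H2]; split.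
      - intros x Hx; cbn; unfold insert; destruct (Nat.eqb_spec x i); [lia|].
        apply greedy_limit; lia.
      - intros m; pose proof (mass_insert i (set_of (greedy G k i)) m).
        pose proof (mass_greedy G k i m); pose proof (unitfrac_anti j i Hj).
        cbn [add set_of proj1_sig t] in *; unfold set_of in *; lra. }
    split; [apply HWF, Hl, Hn; lia|apply Hl', Hn; lia]. }
  pose proof (mass_diverges (limit G k) n ltac:(lia) Hall) as Hdiv.
  pose proof (Hlim (n + n)) as Hb2.
  pose proof (mass_mono (limit G k) 0 n ltac:(lia)) as Hnn; cbn [mass] in Hnn.
  assert (Hsmall : (b <= unitfrac 2)%Q) by (apply unitfrac_anti; lia).
  change (unitfrac 2) with (1 # 3)%Q in Hsmall; lra.
Qed.

(** * Independence *)

Lemma unprovable (A : form) (e : nat -> name ideal) :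
  ~ sat e A emptyset -> ~ proves intuitionistic IZF_Ref A.
Proof.
  intros H HA; apply H, (soundness ideal IZF_Ref) with (G := []); auto.
  - intros B HB; apply IZF_Ref_valid, HB.
  - intros B [].
Qed.

Theorem theorem2p1 :
  consistent classical ZF ->
  ~ proves intuitionistic IZF_Ref every_Cauchy_has_modulus /\
  ~ proves intuitionistic IZF_Ref every_Cauchy_of_pairs_converges.
Proof.
  intros _; split; apply (unprovable _ (env [])); intros H;
    apply not_approximable.
  - exact (modulus_approximates ideal partial partial_const partial_cauchy _ H).
  - exact (pairs_approximate ideal partial partial_const partial_cauchy _ H).
Qed.
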